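(* Let $A$ be a $C^*$-algebra and let $p$ and $q$ be two $\sigma$-compact open projections of $A$. Suppose that there is a continuous path of unitaries $\{w(t):t\in[0,1)\}\subset M(A)$ such that $w(0)=1$ and, for any $n\ge1$, there is $t_n\in(0,1)$ such that $$w(t)p_{K,n}w(t)^*=w(t_n)p_{K,n}w(t_n)^*\quad\text{for all }t\in[t_n,1),$$ where $\{p_{K,n}\}$ is a precompact support for $p$ and $\{w(t_n)p_{K,n}w(t_n)^*\}$ is a precompact support for $q$. Suppose moreover that $$w(t)p_{K,n}=\lambda(t)\,w(t_n)p_{K,n}\quad\text{for all }t\in[t_n,1)$$ for some $\lambda(t)\in\mathbb{C}$. Then $[p]=[q]$.
   Context: $A^{**}$ is the enveloping von Neumann algebra of $A$, and $M(A)\subset A^{**}$ is the multiplier algebra of $A$. For $a\in A_+$, $p_a\in A^{**}$ denotes the range projection of $a$, an open projection of $A$. An open projection $p$ of $A$ is $\sigma$-compact if $p=p_a$ for some $a\in A_+$. For an open projection $p$, $Her(p)=pA^{**}p\cap A$. Cuntz equivalence of open projections: $[p]=[q]$ (also written $p\approx_{cu}q$) means that there is a partial isometry $v\in A^{**}$ with $v^*v=p$, $vv^*=q$, and $vav^*\in Her(q)$ for all $a\in Her(p)$. Precompact support: let $p$ be a $\sigma$-compact open projection of $A$ which is not in $A$, let $a\in Her(p)$ be a strictly positive element (then $0$ is a limit point of the spectrum of $a$), and let $s_n\in(0,\|a\|]$ with $s_n\searrow 0$. Let $p_{K,n}$ be the open spectral projection of $a$ in $A^{**}$ corresponding to $(s_n,\|a\|]$.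 Such a sequence $\{p_{K,n}\}$ is called a precompact support of $p$; it is increasing and converges to $p$ in the strong operator topology in $A^{**}$. *)

(* Defs.v *)
From HB Require Import structures.
From mathcomp Require Import all_boot all_order all_algebra.
From mathcomp Require Import sesquilinear.
From mathcomp Require Import complex.
From mathcomp Require Import all_classical all_reals all_analysis.
Set Implicit Arguments.
Unset Strict Implicit.
Unset Printing Implicit Defensive.
Import Order.TTheory GRing.Theory Num.Theory.
Import numFieldNormedType.Exports.
Local Open Scope classical_set_scope.
Local Open Scope complex_scope.
Local Open Scope ring_scope.

(* C*-algebras need not have a unit, so the product cannot come from MathComp's
   (unital) ring structures. *)
HB.mixin Record isCStarAlgebra (R : realType) A
    of CompleteNormedModule R[i] A := {
  cmul : A -> A -> A ;
  cstar : A -> A ;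
  cmulA : associative cmul ;
  cmul_linearl : forall b : A, linear (fun a => cmul a b) ;
  cmul_linearr : forall a : A, linear (cmul a) ;
  cstarK : involutive cstar ;
  cstar_antilinear : forall (c : R[i]) (a b : A),
    cstar (c *: a + b) = Num.conj c *: cstar a + cstar b ;
  cstarM : forall a b : A, cstar (cmul a b) = cmul (cstar b) (cstar a) ;
  cnormM : forall a b : A, `|cmul a b| <= `|a| * `|b| ;
  cnorm_star : forall a : A, `|cmul (cstar a) a| = `|a| ^+ 2
}.

#[short(type="cstarAlgType")]
HB.structure Definition CStarAlgebra (R : realType) :=
  {A of CompleteNormedModule R[i] A & isCStarAlgebra R A}.

(* [dotp] is linear in its first argument and conjugate-linear in the second. *)
HB.mixin Record isHilbert (R : realType) H of CompleteNormedModule R[i] H := {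
  dotp : {dot H for Num.conj} ;
  dotpE : forall x : H, dotp x x = `|x| ^+ 2
}.

#[short(type="hilbertType")]
HB.structure Definition Hilbert (R : realType) :=
  {H of CompleteNormedModule R[i] H & isHilbert R H}.

(* MathComp norms over [R[i]] take their (real) values in [R[i]]. *)
Definition rnorm (R : realType) (V : normedModType R[i]) (x : V) : R :=
  complex.Re `|x|.

Definition opnorm (R : realType) (V W : normedModType R[i]) (f : V -> W) : R :=
  sup [set rnorm (f x) | x in [set x : V | rnorm x <= 1]].

Section CStar.
Context {R : realType} {A : cstarAlgType R}.

Definition cpos : set A := [set a | exists b, a = cmul (cstar b) b].

(* [sup] is [0] on a set that is not bounded above, so [opnorm f = 1] entails
   that [f] is bounded. *)
Definition state (f : A -> R[i]) : Prop :=
  [/\ scalar f, (forall a, cpos a -> 0 <= f a) & opnorm (f : A -> R[i]^o) = 1].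

(* [a] is a strictly positive element of the C*-subalgebra [B]: every nonzero
   positive linear functional on [B] is strictly positive at [a].  Such
   functionals are automatically bounded; only their values on [B] matter. *)
Definition strictly_positive (B : set A) (a : A) : Prop :=
  [/\ B a, cpos a &
    forall f : A -> R[i],
      (forall c x y, B x -> B y -> f (c *: x + y) = c * f x + f y) ->
      (forall x, B x -> 0 <= f (cmul (cstar x) x)) ->
      (exists2 x, B x & f x != 0) ->
      0 < f a].

End CStar.

Section Operators.
Context {R : realType} {H : hilbertType R}.
Implicit Types (S T p u : H -> H).

Definition bounded_op T : Prop := linear T /\ continuous T.

(* For a bounded operator the adjoint exists (Riesz) and is unique. *)
Definition adj T : H -> H :=
  get [set S | forall x y : H, dotp (T x) y = dotp x (S y)].

Definition commutant (M : set (H -> H)) : set (H -> H) :=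
  [set T | bounded_op T /\ forall S, M S -> T \o S = S \o T].

Definition projection p : Prop := [/\ bounded_op p, p \o p = p & adj p = p].

Definition unitary u : Prop :=
  [/\ bounded_op u, u \o adj u = id & adj u \o u = id].

Definition partial_isometry u : Prop :=
  bounded_op u /\ projection (adj u \o u).

End Operators.

Section Enveloping.
Context {R : realType} {A : cstarAlgType R} {H : hilbertType R}.
Variable pi : A -> H -> H.
Implicit Types (p q : H -> H) (a b : A).

Definition star_representation : Prop :=
  [/\ (forall a, bounded_op (pi a)),
      (forall (c : R[i]) a b x, pi (c *: a + b) x = c *: pi a x + pi b x),
      (forall a b, pi (cmul a b) = pi a \o pi b) &
      (forall a, pi (cstar a) = adj (pi a))].

(* [pi] is the universal representation of [A], the Hilbert space direct sum of
   the GNS representations of all the states of [A].  The direct sum is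
   expressed internally: [xi f] is the cyclic vector of the summand of [f], and
   this determines [(H, pi)] up to unitary equivalence. *)
Definition universal_representation : Prop :=
  star_representation /\
  exists xi : (A -> R[i]) -> H,
    [/\ (forall f, state f -> forall a, f a = dotp (pi a (xi f)) (xi f)),
        (forall f, state f -> closure (range (pi ^~ (xi f))) (xi f)),
        (forall f g, state f -> state g -> f <> g ->
           forall a b, dotp (pi a (xi f)) (pi b (xi g)) = 0) &
        closure [set x : H | exists n (f : 'I_n -> A -> R[i]) (a : 'I_n -> A),
          (forall i, state (f i)) /\ x = \sum_(i < n) pi (a i) (xi (f i))]
        = setT].

(* [A**], for [pi] universal; [A] sits inside it as [range pi]. *)
Definition envelope : set (H -> H) := commutant (commutant (range pi)).

Definition multiplier : set (H -> H) :=
  [set x | envelope x /\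
           forall a, range pi (x \o pi a) /\ range pi (pi a \o x)].

(* Akemann: [p] is the strong limit of an increasing net of positive elements
   of [A]. *)
Definition open_projection p : Prop :=
  [/\ projection p, envelope p &
    exists (I : Type) (le : I -> I -> Prop) (u : I -> A),
      [/\ [/\ inhabited I, (forall i, le i i),
              (forall i j k, le i j -> le j k -> le i k) &
              (forall i j, exists2 k, le i k & le j k)],
          (forall i, cpos (u i)),
          (forall i j, le i j -> cpos (u j - u i)) &
          (forall (x : H) (e : R), 0 < e -> exists i0, forall i, le i0 i ->
             rnorm (pi (u i) x - p x) < e)]].

Definition range_projection a p : Prop :=
  projection p /\ range p = closure (range (pi a)).

Definition sigma_compact_open p : Prop :=
  open_projection p /\ exists2 a, cpos a & range_projection a p.

Definition her p : set A :=
  [set a | exists2 x, envelope x & pi a = p \o x \o p].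

(* Weak form of [a = \int t dE t], for [a] positive; the measures [mu] also carry
   the countable additivity of [E]. *)
Definition spectral_measure a (E : set R -> H -> H) : Prop :=
  [/\ (forall B, measurable B -> projection (E B) /\ envelope (E B)),
      (forall B C, measurable B -> measurable C -> E (B `&` C) = E B \o E C),
      E setT = id,
      E `[0, rnorm a]%classic = id &
      forall x : H, exists mu : {finite_measure set R -> \bar R},
        (forall B, measurable B -> dotp (E B x) x = (fine (mu B))%:C) /\
        dotp (pi a x) x = (\int[mu]_(t in `[0, rnorm a]) t)%:C].

Definition precompact_support p (pK : nat -> H -> H) : Prop :=
  [/\ sigma_compact_open p, ~ range pi p &
    exists (a : A) (s : nat -> R) (E : set R -> H -> H),
      [/\ strictly_positive (her p) a,
          (forall n, 0 < s n <= rnorm a),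
          nonincreasing_seq s /\ s @ \oo --> 0,
          spectral_measure a E &
          forall n, pK n = E `]s n, rnorm a]%classic]].

Definition cuntz_equivalent p q : Prop :=
  exists v : H -> H,
    [/\ envelope v, partial_isometry v, adj v \o v = p, v \o adj v = q &
        forall a, her p a ->
          exists2 b, her q b & v \o pi a \o adj v = pi b].

End Enveloping.

(* Continuity on [[0, 1)] for the operator norm. *)
Definition norm_continuous_path (R : realType) (H : hilbertType R)
    (w : R -> H -> H) : Prop :=
  forall t, t \in `[0, 1[ ->
    opnorm (fun x => w s x - w t x) @[s --> within `[0, 1[ (nbhs t)] --> 0.

(* Main.v *)
(* The unitaries [w (t n)] agree on the ranges of the [pK n] up to phases.  After
   correcting the phases they give unitary multipliers [V n] with
   [V m pK_n = V n pK_n] for [n <= m], and [v = lim (V n) p] (strong limit)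
   satisfies [v* v = p] and [v v* = q].  For [b] in [Her(p)] strict positivity
   forces [pi b (1 - pK n) -> 0] in norm, so [v b v*] is the norm limit of the
   [V n b (V n)*], which lie in [A]; it lies in [A] because the universal
   representation is isometric.  The isometry is the Gelfand-Naimark theorem:
   every self-adjoint [a] has a state [f] with [f (a a) = |a| ^+ 2]. *)
From HB Require Import structures.
Require Import Defs.
From mathcomp Require Import all_boot all_order all_algebra complex.
From mathcomp Require Import sesquilinear.
From mathcomp Require Import all_classical all_reals all_analysis.
From mathcomp Require Import measurable_realfun.
From mathcomp Require Import ring lra.
Set Implicit Arguments.
Unset Strict Implicit.
Unset Printing Implicit Defensive.
Import Order.TTheory GRing.Theory Num.Theory.
Import numFieldNormedType.Exports.
Local Open Scope classical_set_scope.
Local Open Scope complex_scope.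
Local Open Scope ring_scope.

(** * Real-valued norms *)

(** The unitaries converge at best strongly, and a strong limit of elements of [A] need not lie in
    [A]. What saves membership is a cut: [b] is close in norm to [pK n b pK n], and on the range of
    [pK n] the operators [V n] and [v] coincide, so their conjugates of [b] are close in norm.

    Strict positivity is a condition on functionals, so the norm estimate for the tails is obtained
    by contradiction from a functional. Hahn-Banach produces it below an upper limit of vector
    functionals, which replaces a weak-* cluster point.

    The universal representation is known through its states, hence the norm of [A] must be
    recovered from states. Positivity is developed without spectra for this purpose: [k] is positive
    when it is within [l] of [l] times the unit, square roots come from a contraction, and the
    positivity of [a* a] (Kaplansky) makes a norm-one functional with value 1 at the unit a
    state. *)

Section Modulus.
Context {R : realType}.
Implicit Types (z : R[i]) (r : R).

Definition cmod z : R := complex.Re `|z|.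

Lemma cmodE z : `|z| = (cmod z)%:C.
Proof. by rewrite /cmod normc_def. Qed.

Lemma cmod_ge0 z : 0 <= cmod z.
Proof. by rewrite -ler0c -cmodE. Qed.

Lemma cmodM z1 z2 : cmod (z1 * z2) = cmod z1 * cmod z2.
Proof. by apply: complexI; rewrite rmorphM -!cmodE normrM. Qed.

Lemma cmod_real r : cmod r%:C = `|r|.
Proof. by rewrite /cmod normc_def /= expr0n addr0 sqrtr_sqr. Qed.

Lemma cmod0 : cmod 0 = 0. Proof. by rewrite /cmod normr0. Qed.
Lemma cmod1 : cmod 1 = 1. Proof. by rewrite /cmod normr1. Qed.
Lemma cmodN z : cmod (- z) = cmod z. Proof. by rewrite /cmod normrN. Qed.
Lemma cmodi : cmod 'i = 1.
Proof. by rewrite /cmod normc_def /= expr0n add0r expr1n sqrtr1. Qed.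

Lemma cmodD z1 z2 : cmod (z1 + z2) <= cmod z1 + cmod z2.
Proof. by rewrite -lecR rmorphD /= -!cmodE ler_normD. Qed.

Lemma cmod_conj z : cmod z^* = cmod z.
Proof. by rewrite /cmod normcJ. Qed.

Lemma cmod_eq0 z : cmod z = 0 -> z = 0.
Proof. by move=> z0; apply/eqP; rewrite -normr_eq0 cmodE z0. Qed.

Lemma Re_le_cmod z : complex.Re z <= cmod z.
Proof.
have := normc_ge_Re z; rewrite cmodE lecR; apply: le_trans; exact: ler_norm.
Qed.

Lemma cmod_sqr z : cmod z ^+ 2 = complex.Re z ^+ 2 + complex.Im z ^+ 2.
Proof.
by rewrite /cmod normc_def /= sqr_sqrtr // addr_ge0 // sqr_ge0.
Qed.

Lemma cmod_le_ReIm z : cmod z <= `|complex.Re z| + `|complex.Im z|.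
Proof.
rewrite -(@ler_pXn2r _ 2) ?nnegrE ?cmod_ge0 ?addr_ge0 // cmod_sqr sqrrD !real_normK ?num_real //.
by rewrite lerD2r lerDl mulrn_wge0 // mulr_ge0.
Qed.

Lemma mul_conjc z : z * z^*%C = (cmod z ^+ 2)%:C.
Proof. by rewrite -sqr_normc cmodE rmorphXn. Qed.

Lemma ge0_Re z : 0 <= z -> z = (complex.Re z)%:C /\ 0 <= complex.Re z.
Proof.
move=> z0; have := z0; rewrite lecE /= => /andP[/eqP im re].
by split=> //; case: z im {z0 re} => a b /= ->.
Qed.

(** The phase turns bounds on real parts into bounds on moduli, and makes an inner product real in
    the Cauchy-Schwarz inequality. *)
Lemma rotate_cmod z : exists2 u : R[i], cmod u = 1 & u * z = (cmod z)%:C.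
Proof.
have [->|z0] := eqVneq z 0; first by exists 1; rewrite ?cmod1 // mulr0 cmod0.
have m0 : cmod z != 0 by apply: contra_neq z0; exact: cmod_eq0.
exists ((cmod z)^-1%:C * z^*%C).
  rewrite cmodM cmod_real cmod_conj ger0_norm ?invr_ge0 ?cmod_ge0 //.
  by rewrite mulVf.
rewrite -mulrA [_^*%C * _]mulrC mul_conjc -rmorphM /= expr2 mulrA mulVf //.
by rewrite mul1r.
Qed.

End Modulus.

Section LinearProp.
Context {K : pzRingType} {V W : lmodType K} (f : V -> W).
Hypothesis fl : linear f.

Lemma lin0 : f 0 = 0.
Proof.
by have := fl 1 0 0; rewrite !scale1r addr0 => /eqP; rewrite -subr_eq subrr eq_sym => /eqP.
Qed.

Lemma linD x y : f (x + y) = f x + f y.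
Proof. by rewrite -{1}(scale1r x) fl scale1r. Qed.

Lemma linZ c x : f (c *: x) = c *: f x.
Proof. by rewrite -{1}(addr0 (c *: x)) fl lin0 addr0. Qed.

Lemma linN x : f (- x) = - f x.
Proof. by rewrite -!scaleN1r linZ. Qed.

Lemma linB x y : f (x - y) = f x - f y.
Proof. by rewrite linD linN. Qed.

End LinearProp.

Section RealNorm.
Context {R : realType} {V : normedModType R[i]}.
Implicit Types (x y z : V) (u : nat -> V).

Lemma rnormE x : `|x| = (rnorm x)%:C.
Proof. by rewrite /rnorm; case: (ge0_Re (normr_ge0 x)). Qed.

Lemma rnorm_ge0 x : 0 <= rnorm x.
Proof. by case: (ge0_Re (normr_ge0 x)). Qed.

Lemma rnorm0 : rnorm (0 : V) = 0. Proof. by rewrite /rnorm normr0. Qed.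

Lemma rnormN x : rnorm (- x) = rnorm x. Proof. by rewrite /rnorm normrN. Qed.

Lemma rnormD x y : rnorm (x + y) <= rnorm x + rnorm y.
Proof. by rewrite -lecR rmorphD /= -!rnormE ler_normD. Qed.

Lemma rnormB x y : rnorm (x - y) <= rnorm x + rnorm y.
Proof. by rewrite -(rnormN y) rnormD. Qed.

Lemma rnormC x y : rnorm (x - y) = rnorm (y - x).
Proof. by rewrite -rnormN opprB. Qed.

Lemma rnorm_tri z x y : rnorm (x - y) <= rnorm (x - z) + rnorm (z - y).
Proof. by rewrite -(subrKA z) rnormD. Qed.

Lemma rnorm_lip x y : rnorm x <= rnorm y + rnorm (x - y).
Proof. by rewrite -{1}(subrKC y x) rnormD. Qed.

Lemma rnormZ (c : R[i]) x : rnorm (c *: x) = cmod c * rnorm x.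
Proof. by rewrite {1}/rnorm normrZ cmodE rnormE -rmorphM. Qed.

Lemma rnorm_eq0 x : rnorm x = 0 -> x = 0.
Proof. by move=> x0; apply/eqP; rewrite -normr_eq0 rnormE x0. Qed.

Lemma rnorm_gt0 x : x != 0 -> 0 < rnorm x.
Proof.
move=> x0; rewrite lt_def rnorm_ge0 andbT.
by apply: contra_neq x0; exact: rnorm_eq0.
Qed.

Lemma rnorm_small0 x : (forall e : R, 0 < e -> rnorm x <= e) -> x = 0.
Proof.
move=> H; apply: rnorm_eq0; apply/eqP; rewrite eq_le rnorm_ge0 andbT.
by apply/ler_addgt0Pr => e e0; rewrite add0r H.
Qed.

(** Limits are taken along sequences with a real [e], since the norm itself takes its values in
    [R[i]]. *)
Definition rlim u x : Prop :=
  forall e : R, 0 < e -> exists n0, forall n, (n0 <= n)%N -> rnorm (u n - x) < e.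

Lemma rlim_uniq u x y : rlim u x -> rlim u y -> x = y.
Proof.
move=> ux uy; apply/eqP; rewrite -subr_eq0; apply/eqP; apply: rnorm_small0 => e e0.
have e2 : 0 < e / 2 by rewrite divr_gt0.
have [n1 h1] := ux _ e2; have [n2 h2] := uy _ e2.
have := rnorm_tri (u (maxn n1 n2)) x y.
have := h1 _ (leq_maxl n1 n2); have := h2 _ (leq_maxr n1 n2).
rewrite [rnorm (x - u _)]rnormC; lra.
Qed.

Lemma rlim_rnorm_le u x (C : R) n0 :
  rlim u x -> (forall n, (n0 <= n)%N -> rnorm (u n) <= C) -> rnorm x <= C.
Proof.
move=> ux uC; apply/ler_addgt0Pr => e e0.
have [n1 h1] := ux _ e0.
have := rnorm_lip x (u (maxn n0 n1)); rewrite rnormC.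
have := h1 _ (leq_maxr n0 n1); have := uC _ (leq_maxl n0 n1); lra.
Qed.

Lemma rlimD u v x y : rlim u x -> rlim v y -> rlim (fun n => u n + v n) (x + y).
Proof.
move=> ux vy e e0; have e2 : 0 < e / 2 by rewrite divr_gt0.
have [n1 h1] := ux _ e2; have [n2 h2] := vy _ e2.
exists (maxn n1 n2) => n; rewrite geq_max => /andP[/h1 + /h2].
rewrite opprD addrACA; have := rnormD (u n - x) (v n - y); lra.
Qed.

Lemma rlimZ u x (c : R[i]) : rlim u x -> rlim (fun n => c *: u n) (c *: x).
Proof.
move=> ux e e0.
have c1 : 0 < cmod c + 1 by rewrite ltr_wpDl ?cmod_ge0.
have [n1 h1] := ux _ (divr_gt0 e0 c1); exists n1 => n /h1.
rewrite -scalerBr rnormZ ltr_pdivlMr //; apply: le_lt_trans.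
rewrite mulrC ler_wpM2l ?rnorm_ge0 //; lra.
Qed.

Lemma closureP (S : set V) x :
  closure S x <-> forall e : R, 0 < e -> exists2 y, S y & rnorm (x - y) < e.
Proof.
split=> [Sx e e0|Sx B].
  have [|y [Sy]] := Sx (ball x e%:C).
    by apply: nbhsx_ballx; rewrite ltcR.
  by rewrite -ball_normE /= rnormE ltcR => xy; exists y.
move=> /nbhs_ballP[e /= e0 eB].
have [e0' er] := ge0_Re (ltW e0).
have [|y Sy xy] := Sx (complex.Re e).
  by rewrite -ltcR -e0'.
by exists y; split=> //; apply: eB; rewrite -ball_normE /= rnormE e0' ltcR.
Qed.

End RealNorm.

Lemma rcomplete (R : realType) (V : completeNormedModType R[i]) (u : nat -> V) :
  (forall e : R, 0 < e ->
     exists n0, forall m n, (n0 <= m)%N -> (n0 <= n)%N -> rnorm (u m - u n) < e) ->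
  exists x, rlim u x.
Proof.
move=> uC.
have /cauchy_cvgP/cvg_ex[x ux] : cauchy (u @ \oo).
  apply: cauchy_exP => e e0.
  have [e0' er] := ge0_Re (ltW e0).
  have [|n0 hn0] := uC (complex.Re e); first by rewrite -ltcR -e0'.
  exists (u n0), n0 => // n /= n0n.
  by rewrite -ball_normE /= rnormE e0' ltcR; exact: hn0.
exists x => e e0.
have ec0 : 0 < e%:C by rewrite ltcR.
have [n0 _ h] := (@cvgrPdist_lt _ _ _ _ _ _ _).1 ux _ ec0.
by exists n0 => n /h /=; rewrite rnormE ltcR rnormC.
Qed.

Lemma linear_bounded (R : realType) (V W : normedModType R[i]) (f : V -> W) :
  linear f -> continuous f ->
  exists2 C : R, 0 < C & forall x, rnorm (f x) <= C * rnorm x.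
Proof.
move=> fl fc.
have := fc 0; move=> /cvgrPdist_lt /(_ 1 ltr01) /nbhs_ballP[d /= d0 hd].
have [d0' dr] := ge0_Re (ltW d0).
have d1 : 0 < complex.Re d by rewrite -ltcR -d0'.
have f0 : f 0 = 0 := lin0 fl.
exists (2 / complex.Re d); first by rewrite divr_gt0.
move=> x; have [->|x0] := eqVneq x 0; first by rewrite f0 !rnorm0 mulr0.
have nx := rnorm_gt0 x0.
pose c := complex.Re d / 2 / rnorm x.
have c0 : 0 < c by rewrite !divr_gt0.
have := hd (c%:C *: x).
rewrite /= -?ball_normE /= f0 !sub0r !normrN !rnormE (linZ fl) !rnormZ cmod_real gtr0_norm //.
rewrite d0' !ltcR => h.
have {h} : c * rnorm (f x) < 1 by apply: h; rewrite /c divfK ?gt_eqF //; lra.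
rewrite /c /= => h; rewrite mulrAC ler_pdivlMr //.
have : complex.Re d / 2 * rnorm (f x) < rnorm x.
  rewrite -(ltr_pM2r (x := (rnorm x)^-1)) ?invr_gt0 // divff ?gt_eqF //.
  by rewrite mulrAC.
lra.
Qed.

Lemma bounded_linear (R : realType) (V W : normedModType R[i]) (f : V -> W) (C : R) :
  linear f -> (forall x, rnorm (f x) <= C * rnorm x) -> continuous f.
Proof.
move=> fl fC x.
have C1 : 0 < `|C| + 1 by rewrite ltr_wpDl.
apply/cvgrPdist_lt => e e0.
have [e0' er] := ge0_Re (ltW e0).
have re0 : 0 < complex.Re e by rewrite -ltcR -e0'.
apply/nbhs_ballP; exists (complex.Re e / (`|C| + 1))%:C => /=.
  by rewrite ltcR divr_gt0.
move=> y; rewrite -ball_normE /= -(linB fl) !rnormE e0' !ltcR ltr_pdivlMr // => h.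
apply: le_lt_trans (fC _) _; apply: le_lt_trans h.
rewrite mulrC ler_wpM2l ?rnorm_ge0 //; have := ler_norm C; lra.
Qed.

(** * Hahn-Banach *)

Section HahnBanach.
Context {R : realType} {V : lmodType R}.
Implicit Types (p g : V -> R) (x y : V).

Definition sublinear p : Prop :=
  (forall x y, p (x + y) <= p x + p y) /\
  (forall (r : R) x, 0 <= r -> p (r *: x) = r * p x).

Lemma sublinear0 p : sublinear p -> p 0 = 0.
Proof. by case=> _ pZ; rewrite -(scale0r 0) pZ // mul0r. Qed.

Lemma sublinear_opp_ge p x : sublinear p -> - p (- x) <= p x.
Proof.
move=> ps; have := ps.1 x (- x); rewrite subrr sublinear0 //; lra.
Qed.

(** One inequality suffices: applied to [r^-1] and [r *: x] it yields the reverse one. *)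
Lemma sublinear_homog p : (forall x y, p (x + y) <= p x + p y) -> p 0 = 0 ->
  (forall (r : R) x, 0 < r -> p (r *: x) <= r * p x) -> sublinear p.
Proof.
move=> pD p0 pZ; split=> // r x; rewrite le_eqVlt => /predU1P[<-|r0].
  by rewrite scale0r mul0r.
apply/eqP; rewrite eq_le pZ //=.
have := pZ r^-1 (r *: x); rewrite scalerA mulVf ?gt_eqF // scale1r invr_gt0.
by move=> /(_ r0); rewrite ler_pdivlMl.
Qed.

(** For sublinear [p], the choice [t = 0] keeps it below [p], and [t = 1] bounds its value at [- y]
    by [- p y]. A linear functional below it is therefore at least [p y] at [y]. *)
Definition shift p y x : R := inf [set p (x + t *: y) - t * p y | t in [set t : R | 0 <= t]].

Lemma shift_lb p y x (t : R) : sublinear p -> 0 <= t -> - p (- x) <= p (x + t *: y) - t * p y.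
Proof.
move=> ps t0; have := ps.1 (x + t *: y) (- x); rewrite addrAC subrr add0r ps.2 //; lra.
Qed.

Lemma shift_has_inf p y x : sublinear p ->
  has_inf [set p (x + t *: y) - t * p y | t in [set t : R | 0 <= t]].
Proof.
move=> ps; split; first by exists (p (x + 0 *: y) - 0 * p y), 0 => //=.
by exists (- p (- x)) => _ [t /= t0 <-]; exact: shift_lb.
Qed.

Lemma shift_le p y x (t : R) : sublinear p -> 0 <= t -> shift p y x <= p (x + t *: y) - t * p y.
Proof.
move=> ps t0; apply: ge_inf; first by case: (shift_has_inf y x ps).
by exists t.
Qed.

Lemma shift_sublinear p y : sublinear p -> sublinear (shift p y).
Proof.
move=> ps; apply: sublinear_homog.
- move=> x1 x2; apply/ler_addgt0Pr => e e0.
  have e2 : 0 < e / 2 by rewrite divr_gt0.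
  have [_ [t1 /= t10 <-] h1] := inf_adherent e2 (shift_has_inf y x1 ps).
  have [_ [t2 /= t20 <-] h2] := inf_adherent e2 (shift_has_inf y x2 ps).
  have := shift_le y (x1 + x2) ps (addr_ge0 t10 t20).
  rewrite scalerDl addrACA; have := ps.1 (x1 + t1 *: y) (x2 + t2 *: y).
  move: h1 h2; rewrite -/(shift p y x1) -/(shift p y x2); lra.
- apply/eqP; rewrite eq_le; apply/andP; split.
    by have := shift_le y 0 ps (lexx 0); rewrite scale0r add0r mul0r subr0 (sublinear0 ps).
  apply: lb_le_inf; first by case: (shift_has_inf y 0 ps).
  move=> _ [t /= t0 <-]; have := shift_lb y 0 ps t0; rewrite oppr0 sublinear0 //; lra.
- move=> r x r0; rewrite -ler_pdivrMl //; apply: lb_le_inf; first by case: (shift_has_inf y x ps).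
  move=> _ [t /= t0 <-]; rewrite ler_pdivrMl //.
  have rt : 0 <= r * t by rewrite mulr_ge0 // ltW.
  have := shift_le y (r *: x) ps rt.
  by rewrite [r * (_ - _)]mulrBr mulrA -scalerA -scalerDr ps.2 // ltW.
Qed.

(* A minimal sublinear functional [g] is additive: [shift g y] is sublinear and
   below [g], hence equal to [g], so [g x <= g (x + y) - g y]. *)
Lemma sublinear_minimal p : sublinear p -> exists g : V -> R,
  [/\ sublinear g, (forall x, g x <= p x) &
      forall h, sublinear h -> (forall x, h x <= g x) -> h = g].
Proof.
move=> ps.
pose T := {g : V -> R | sublinear g /\ forall x, g x <= p x}.
(* The pointwise order is reversed, so that a maximal element for Zorn's lemma is a minimal
   functional. *)
pose le (g h : T) := `[< forall x, sval h x <= sval g x >].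
have [g gmax] : exists g : T, forall h, le g h -> h = g.
  apply: Zorn.
  - by move=> g; apply/asboolP.
  - move=> f g h /asboolP fg /asboolP gh; apply/asboolP => x.
    exact: le_trans (gh x) (fg x).
  - move=> [f fP] [g gP] /asboolP /= fg /asboolP /= gf; apply: eq_exist; apply/funext => x.
    by apply/eqP; rewrite eq_le fg gf.
  move=> A Atot.
  have [[g0 Ag0]|A0] := pselect (exists g : T, A g); last first.
    by exists (exist _ p (conj ps (fun x => lexx _))) => s As; case: A0; exists s.
  pose S x := [set sval c x | c in A].
  have Si x : has_inf (S x).
    split; first by exists (sval g0 x), g0.
    exists (- p (- x)) => _ [[g [gs gp]] Ag <-] /=.
    by have := sublinear_opp_ge x gs; have := gp (- x); lra.
  pose m x := inf (S x).
  have mle (g : T) x : A g -> m x <= sval g x.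
    by move=> Ag; apply: ge_inf; [case: (Si x)|exists g].
  have ms : sublinear m.
    apply: sublinear_homog.
    - move=> x y; apply/ler_addgt0Pr => e e0.
      have e2 : 0 < e / 2 by rewrite divr_gt0.
      have [_ [f Af <-] h1] := inf_adherent e2 (Si x).
      have [_ [g Ag <-] h2] := inf_adherent e2 (Si y).
      rewrite -/(m x) in h1; rewrite -/(m y) in h2.
      (* The lower of two members of the chain serves for both infima, which makes [m]
         subadditive. *)
      have [/asboolP fg|/asboolP gf] := Atot f g Af Ag.
        have := mle g (x + y) Ag; have := (svalP g).1.1 x y; have := fg x; lra.
      have := mle f (x + y) Af; have := (svalP f).1.1 x y; have := gf y; lra.
    - have -> : m 0 = inf [set 0]; last by rewrite inf1.
      congr inf; apply/seteqP; split=> [_ [g Ag <-]|_ ->] /=.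
        by rewrite sublinear0 //; case: (svalP g).
      by exists g0 => //; rewrite sublinear0 //; case: (svalP g0).
    - move=> r x r0; rewrite -ler_pdivrMl //; apply: lb_le_inf; first by case: (Si x).
      move=> _ [g Ag <-]; rewrite ler_pdivrMl //.
      by rewrite -(svalP g).1.2; [exact: mle|exact: ltW].
  have mp x : m x <= p x by apply: le_trans (mle g0 x Ag0) _; case: (svalP g0).
  exists (exist _ m (conj ms mp)) => g Ag; apply/asboolP => x /=; exact: mle.
exists (sval g); case: (svalP g) => gs gp; split=> // h hs hg.
have hp x : h x <= p x by apply: le_trans (hg x) (gp x).
by rewrite -(gmax (exist _ h (conj hs hp))) //; apply/asboolP.
Qed.

(** The minimal functional is taken below [shift p x0] instead of [p]; this forces contact with [p]
    at [x0]. *)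
Theorem hahn_banach p x0 : sublinear p -> exists f : V -> R,
  [/\ linear (f : V -> R^o), (forall x, f x <= p x) & f x0 = p x0].
Proof.
move=> ps; have [g [gs gp gmin]] := sublinear_minimal (shift_sublinear x0 ps).
have gD x y : g (x + y) = g x + g y.
  apply/eqP; rewrite eq_le gs.1 /=.
  have <- : shift g y = g.
    apply: gmin; first exact: shift_sublinear.
    by move=> z; have := shift_le y z gs (lexx 0); rewrite scale0r addr0 mul0r subr0.
  have := shift_le y x gs ler01; rewrite scale1r mul1r.
  have : shift g y y <= g y.
    by have := shift_le y y gs (lexx 0); rewrite scale0r addr0 mul0r subr0.
  have -> : shift g y = g.
    apply: gmin; first exact: shift_sublinear.
    by move=> z; have := shift_le y z gs (lexx 0); rewrite scale0r addr0 mul0r subr0.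
  lra.
have gN x : g (- x) = - g x.
  by have := gD x (- x); rewrite subrr sublinear0 //; lra.
have gp' x : g x <= p x.
  by apply: le_trans (gp x) _; have := shift_le x0 x ps (lexx 0); rewrite scale0r addr0 mul0r subr0.
exists g; split=> //.
- move=> r x y; rewrite gD; congr (_ + _).
  have [r0|r0] := leP 0 r; first by rewrite gs.2.
  rewrite -(opprK r) scaleNr gN gs.2 ?oppr_ge0 ?ltW //.
  by rewrite [RHS]mulNr.
apply/eqP; rewrite eq_le gp' /=.
have := gp (- x0); rewrite gN.
have := shift_le x0 (- x0) ps ler01; rewrite scale1r addNr sublinear0 // mul1r; lra.
Qed.

End HahnBanach.

(** An alias that carries the real structure obtained by restriction of scalars, kept apart from the
    complex structure of [V]. *)
Definition realified (R : realType) (V : lmodType R[i]) : Type := V.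

Section Realified.
Context {R : realType} {V : lmodType R[i]}.

HB.instance Definition _ := GRing.Zmodule.on (realified V).

Let real_scale (r : R) (x : realified V) : realified V := r%:C *: (x : V).

Let real_scaleA a b v : real_scale a (real_scale b v) = real_scale (a * b) v.
Proof. by rewrite /real_scale scalerA rmorphM. Qed.

Let real_scale1 : left_id 1 real_scale.
Proof. by move=> v; rewrite /real_scale scale1r. Qed.

Let real_scaleDr : right_distributive real_scale +%R.
Proof. by move=> a u v; rewrite /real_scale scalerDr. Qed.

Let real_scaleDl v : {morph real_scale^~ v : a b / a + b}.
Proof. by move=> a b; rewrite /real_scale rmorphD scalerDl. Qed.

HB.instance Definition _ := GRing.Zmodule_isLmodule.Build R (realified V)
  real_scaleA real_scale1 real_scaleDr real_scaleDl.

End Realified.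

(** A complex-linear map is determined by its real part [f], as [f x - 'i f ('i x)]. The majorant
    [p] is homogeneous under nonnegative reals only, so that an upper limit of real parts is
    admissible; accordingly only real parts are dominated. *)
Theorem complex_hahn_banach (R : realType) (V : lmodType R[i]) (p : V -> R) (x0 : V) :
  (forall x y, p (x + y) <= p x + p y) ->
  (forall (r : R) x, 0 <= r -> p (r%:C *: x) = r * p x) ->
  exists phi : V -> R[i],
    [/\ scalar phi, (forall x, complex.Re (phi x) <= p x) &
        complex.Re (phi x0) = p x0].
Proof.
move=> pD pZ.
have [f [fl fp f0]] := @hahn_banach R (realified V) p x0 (conj pD pZ).
have fD (x y : V) : f (x + y) = f x + f y := linD fl x y.
have fZ (r : R) (x : V) : f (r%:C *: x) = r * f x := linZ fl r x.
exists (fun x => f x -i* f ('i%C *: x)); split=> // c x y.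
have fc z : f (c *: z) = complex.Re c * f z + complex.Im c * f ('i%C *: z).
  by rewrite {1}(complexE c) scalerDl fD fZ [_ * _%:C]mulrC -scalerA fZ.
rewrite fD scalerDr fD scalerA [_ * c]mulrC -scalerA !fc scalerA.
have -> : ('i%C * 'i%C : R[i]) = (-1)%:C by rewrite -expr2 sqr_i rmorphN.
rewrite fZ; case: c {fc} => a b /=.
by apply/eqP; rewrite eq_complex /=; apply/andP; split; apply/eqP; ring.
Qed.

(** * Unital C*-algebras *)

Lemma geometric_small (R : realType) (rho e : R) : 0 <= rho < 1 -> 0 < e ->
  exists n0, forall n, (n0 <= n)%N -> rho ^+ n < e.
Proof.
move=> /andP[r0 r1] e0.
have rn : `|rho| < 1 by rewrite ger0_norm.
have /cvgrPdist_lt/(_ e e0)[n0 _ h] := cvg_expr rn.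
by exists n0 => n /h /=; rewrite sub0r normrN ger0_norm // exprn_ge0.
Qed.

(** Supplies the exponent in the positivity proof for [star x * x], where [1 + mu] is the norm of
    [1 - star y * y]. *)
Lemma bernoulli_unbounded (R : realType) (mu M : R) : 0 < mu ->
  exists n, M <= mu * (1 + mu) ^+ n.
Proof.
move=> mu0.
have [||n0 /(_ n0 (leqnn _))] := @geometric_small R (1 + mu)^-1 (mu / (`|M| + 1)).
- by rewrite invr_ge0 addr_ge0 ?ltW //= invf_lt1 ?ltrDl // addr_gt0.
- by rewrite divr_gt0 // ltr_wpDl.
move=> h; exists n0.
have p0 : 0 < (1 + mu) ^+ n0 by rewrite exprn_gt0 // addr_gt0.
move: h; rewrite exprVn ltr_pdivlMr ?ltr_wpDl // mulrC ltr_pdivrMr //.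
have := ler_norm M; lra.
Qed.

(** A predicate on an algebra with a real-valued norm and sequential completeness: the unitization
    can satisfy it without being given a topology. *)
Record cstar_norm (R : realType) (U : algType R[i]) (star : U -> U) (N : U -> R) : Prop :=
  CStarNorm {
  ustarK : involutive star ;
  ustarD : {morph star : x y / x + y} ;
  ustarZ : forall (c : R[i]) x, star (c *: x) = c^*%C *: star x ;
  ustarM : forall x y, star (x * y) = star y * star x ;
  unormD : forall x y, N (x + y) <= N x + N y ;
  unormZ : forall (c : R[i]) x, N (c *: x) = cmod c * N x ;
  unormM : forall x y, N (x * y) <= N x * N y ;
  unorm_star : forall x, N (star x * x) = N x ^+ 2 ;
  unorm_eq0 : forall x, N x = 0 -> x = 0 ;
  unorm_complete : forall u : nat -> U,
    (forall e : R, 0 < e -> exists n0, forall m n,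
       (n0 <= m)%N -> (n0 <= n)%N -> N (u m - u n) < e) ->
    exists x, forall e : R, 0 < e -> exists n0, forall n,
       (n0 <= n)%N -> N (u n - x) < e }.

Section UnitalCStar.
Context {R : realType} {U : algType R[i]} (star : U -> U) (N : U -> R).
Hypothesis UN : cstar_norm star N.
Implicit Types (x y z s k : U) (l c : R).

Local Notation "l %:U" := ((l%:C : R[i]) *: (1 : U)) (at level 2, format "l %:U").

Lemma star0 : star 0 = 0.
Proof. by rewrite -[X in star X](scale0r (0 : U)) (ustarZ UN) conjc0 scale0r. Qed.
Lemma starN x : star (- x) = - star x.
Proof. by rewrite -scaleN1r (ustarZ UN) rmorphN rmorph1 scaleN1r. Qed.
Lemma starB x y : star (x - y) = star x - star y.
Proof. by rewrite (ustarD UN) starN. Qed.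
Lemma star1 : star 1 = 1.
Proof. by rewrite -[RHS](ustarK UN) -{2}[star 1]mulr1 (ustarM UN) (ustarK UN) mulr1. Qed.
Lemma starZr l x : star (l%:C *: x) = l%:C *: star x.
Proof. by rewrite (ustarZ UN) conjc_real. Qed.
Lemma starX x n : star (x ^+ n) = star x ^+ n.
Proof.
by elim: n => [|n IH]; rewrite ?expr0 ?star1 // exprS (ustarM UN) IH exprSr.
Qed.

Lemma unorm0 : N 0 = 0.
Proof. by rewrite -(scale0r 0) (unormZ UN) cmod0 mul0r. Qed.
Lemma unormN x : N (- x) = N x.
Proof. by rewrite -scaleN1r (unormZ UN) cmodN cmod1 mul1r. Qed.
Lemma unorm_ge0 x : 0 <= N x.
Proof. by have := unormD UN x (- x); rewrite subrr unorm0 unormN; lra. Qed.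
Lemma unormB x y : N (x - y) <= N x + N y.
Proof. by rewrite -(unormN y) (unormD UN). Qed.
Lemma unormC x y : N (x - y) = N (y - x).
Proof. by rewrite -unormN opprB. Qed.
Lemma unorm_tri z x y : N (x - y) <= N (x - z) + N (z - y).
Proof. by rewrite -(subrKA z) (unormD UN). Qed.
Lemma unormZr l x : 0 <= l -> N (l%:C *: x) = l * N x.
Proof. by move=> l0; rewrite (unormZ UN) cmod_real ger0_norm. Qed.
Lemma unorm1 : N 1 = 1.
Proof.
have := unorm_star UN 1; rewrite star1 mulr1 expr2 => /eqP.
rewrite -{1}[N 1]mulr1 -subr_eq0 -mulrBr mulf_eq0 => /orP[/eqP /(unorm_eq0 UN)/eqP|].
  by rewrite oner_eq0.
by rewrite subr_eq0 => /eqP <-.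
Qed.
Lemma unormU l : 0 <= l -> N l%:U = l.
Proof. by move=> l0; rewrite unormZr // unorm1 mulr1. Qed.

Lemma unorm_starE x : N (star x) = N x.
Proof.
have le y : N y <= N (star y).
  have [->|y0] := eqVneq (N y) 0; first exact: unorm_ge0.
  have yp : 0 < N y by rewrite lt_def y0 unorm_ge0.
  by rewrite -(ler_pM2r yp) -expr2 -(unorm_star UN) (unormM UN).
by apply/eqP; rewrite eq_le le -{2}(ustarK UN x) le.
Qed.

Lemma unorm_sqr_sa s : star s = s -> N (s ^+ 2) = N s ^+ 2.
Proof. by move=> ss; rewrite -(unorm_star UN) ss -expr2. Qed.

Lemma unorm_small0 x : (forall e : R, 0 < e -> N x <= e) -> x = 0.
Proof.
move=> H; apply: (unorm_eq0 UN); apply/eqP; rewrite eq_le unorm_ge0 andbT.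
by apply/ler_addgt0Pr => e e0; rewrite add0r H.
Qed.

(* [w] is the limit of [w_(n+1) = (z + w_n ^+ 2) / 2]. *)
Lemma sqrt_one_sub z : star z = z -> N z < 1 -> exists w : U,
  [/\ star w = w, (forall y, y * z = z * y -> y * w = w * y) & (1 - w) ^+ 2 = 1 - z].
Proof.
move=> zs z1; set rho := N z in z1; have r0 : 0 <= rho := unorm_ge0 z.
pose h : R[i] := (2^-1)%:C.
pose w := fix w n := if n is n'.+1 then h *: (z + w n' ^+ 2) else 0.
have wS n : w n.+1 = h *: (z + w n ^+ 2) by [].
have hN x : N (h *: x) = N x / 2 by rewrite unormZr ?invr_ge0 // mulrC.
have wN n : N (w n) <= rho.
  elim: n => [|n IH]; first by rewrite /= unorm0.
  rewrite wS hN; have := unormD UN z (w n ^+ 2); rewrite -/rho.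
  have := unormM UN (w n) (w n); rewrite -expr2.
  have : N (w n) * N (w n) <= rho * rho by rewrite ler_pM // unorm_ge0.
  have : rho * rho <= rho by rewrite ler_piMr // ltW.
  lra.
have ws n : star (w n) = w n.
  elim: n => [|n IH]; first by rewrite /= star0.
  by rewrite wS starZr (ustarD UN) zs starX IH.
have wc y n : y * z = z * y -> y * w n = w n * y.
  move=> yz; elim: n => [|n IH]; first by rewrite /= mulr0 mul0r.
  rewrite wS -scalerAr -scalerAl; congr (_ *: _).
  by rewrite mulrDr mulrDl yz expr2 mulrA IH -mulrA IH mulrA.
have sqB x y : N (x ^+ 2 - y ^+ 2) <= (N x + N y) * N (x - y).
  have -> : x ^+ 2 - y ^+ 2 = x * (x - y) + (x - y) * y.
    by rewrite mulrBr mulrBl addrA subrK.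
  have := unormD UN (x * (x - y)) ((x - y) * y).
  have := unormM UN x (x - y); have := unormM UN (x - y) y; lra.
(* On the ball of radius [rho] the iteration contracts by the factor [(rho + rho) / 2]. *)
have wd n : N (w n.+1 - w n) <= rho ^+ n.
  elim: n => [|n IH].
    rewrite expr0 subr0 wS hN expr0n addr0 -/rho; lra.
  rewrite !wS -scalerBr hN opprD addrACA subrr add0r [rho ^+ n.+1]exprS.
  have := sqB (w n.+1) (w n); rewrite -wS.
  have : (N (w n.+1) + N (w n)) * N (w n.+1 - w n) <= (rho + rho) * rho ^+ n.
    by rewrite ler_pM // ?addr_ge0 ?unorm_ge0 // lerD.
  lra.
have d0 : 0 < 1 - rho by rewrite subr_gt0.
(* The telescoped geometric sum, multiplied through by [1 - rho]. *)
have wd2 n j : N (w (n + j)%N - w n) * (1 - rho) <= rho ^+ n - rho ^+ (n + j).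
  elim: j => [|j IH]; first by rewrite addn0 !subrr unorm0 mul0r.
  rewrite addnS.
  have := unorm_tri (w (n + j)%N) (w (n + j).+1) (w n).
  rewrite -(ler_pM2r d0) mulrDl.
  have : N (w (n + j).+1 - w (n + j)%N) * (1 - rho) <= rho ^+ (n + j) * (1 - rho).
    by rewrite ler_pM2r.
  rewrite exprS; move: IH; lra.
have [|v wv] := unorm_complete UN (u := w).
  move=> e e0.
  have [||n0 hn0] := @geometric_small R rho (e * (1 - rho) / 2) _ _.
  - by rewrite r0.
  - by rewrite divr_gt0 // mulr_gt0.
  have small n : (n0 <= n)%N -> N (w n - w n0) < e / 2.
    move=> n0n; rewrite -(ltr_pM2r d0).
    have := wd2 n0 (n - n0)%N; rewrite subnKC // => le1.
    have := hn0 _ (leqnn _); have : 0 <= rho ^+ n by rewrite exprn_ge0.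
    move: le1; lra.
  exists n0 => m n /small hm /small hn.
  have := unorm_tri (w n0) (w m) (w n); rewrite [N (w n0 - _)]unormC; lra.
(* Each identity for the limit [v] is reduced to this: its defect is controlled by the distances of
   two consecutive iterates to [v]. *)
have small (y : U) (C : R) : 0 <= C -> (forall n, N y <= C * (N (w n.+1 - v) + N (w n - v))) -> y = 0.
  move=> C0 H; apply: unorm_small0 => e e0.
  have C1 : 0 < 2 * (C + 1) by rewrite mulr_gt0 // ltr_wpDl.
  have [n0 h0] := wv _ (divr_gt0 e0 C1).
  have := h0 _ (leqnn _); have := h0 _ (leqnSn _).
  rewrite !ltr_pdivlMr // => h1 h2.
  apply: le_trans (H n0) _.
  have := unorm_ge0 (w n0 - v); have := unorm_ge0 (w n0.+1 - v).
  move: h1 h2; nra.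
exists v; split.
- apply/eqP; rewrite -subr_eq0; apply/eqP; apply: (small _ 2) => // n.
  apply: le_trans (unorm_tri (w n) _ _) _.
  rewrite -{1}(ws n) -starB unorm_starE unormC.
  have := unorm_ge0 (w n.+1 - v); lra.
- move=> y yz; apply/eqP; rewrite -subr_eq0; apply/eqP.
  apply: (small _ (2 * N y)) => [|n]; first by rewrite mulr_ge0 ?unorm_ge0.
  have -> : y * v - v * y = (w n - v) * y - y * (w n - v).
    by rewrite mulrBr mulrBl wc // opprB [RHS]addrC addrA subrK.
  apply: le_trans (unormB _ _) _.
  have := unormM UN (w n - v) y; have := unormM UN y (w n - v).
  have : 0 <= N y * N (w n.+1 - v) by rewrite mulr_ge0 ?unorm_ge0.
  lra.
(* The fixed-point equation is [(1 - v) ^+ 2 = 1 - z] in disguise. *)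
have fixv : v = h *: (z + v ^+ 2).
  apply/eqP; rewrite -subr_eq0; apply/eqP.
  have Nv := unorm_ge0 v.
  apply: (small _ (1 + rho + N v)) => [|n]; first by rewrite !addr_ge0.
  apply: le_trans (unorm_tri (w n.+1) _ _) _.
  rewrite unormC {2}wS -scalerBr hN opprD addrACA subrr add0r.
  have := sqB (w n) v.
  have : (N (w n) + N v) * N (w n - v) <= (rho + N v) * N (w n - v).
    by rewrite ler_wpM2r ?unorm_ge0 // lerD2r.
  have := unorm_ge0 (w n - v).
  have : 0 <= (rho + N v) * N (w n.+1 - v) by rewrite mulr_ge0 ?unorm_ge0 ?addr_ge0.
  have : 0 <= (rho + N v) * N (w n - v) by rewrite mulr_ge0 ?unorm_ge0 ?addr_ge0.
  rewrite !mulrDr !mulrDl; lra.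
have fix2 : z = 2 *: v - v ^+ 2.
  have h2 : 2 * h = 1 by rewrite /h -[2](rmorph_nat (real_complex R)) -rmorphM mulfV.
  by rewrite {1}fixv scalerA h2 scale1r addrK.
rewrite -opprB sqrrN sqrrB1 [in RHS]fix2 opprB scaler_nat.
by rewrite [RHS]addrC.
Qed.

Lemma mul_conj_comm y s : s * y = y * s ->
  (y - 'i%C *: s) * (y + 'i%C *: s) = y ^+ 2 + s ^+ 2.
Proof.
move=> sy; rewrite mulrDr !mulrBl -!scalerAl -!scalerAr sy !addrA.
by rewrite addrNK -!expr2 scalerA -expr2 sqr_i scaleN1r opprK.
Qed.

Lemma unorm_sub_sqr s (m : R) : star s = s -> N s ^+ 2 <= m -> N (m%:U - s ^+ 2) <= m.
Proof.
(* For [N s < 1], [y + i s] with [y = sqrt (1 - s ^+ 2)] is unitary. *)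
have unit s' : star s' = s' -> N s' < 1 -> N (1 - s' ^+ 2) <= 1.
  move=> ss s1.
  have [||w [ws wc wE]] := @sqrt_one_sub (s' ^+ 2).
  - by rewrite starX ss.
  - by rewrite unorm_sqr_sa // expr_lt1 ?unorm_ge0.
  pose y := 1 - w; rewrite -wE -/y.
  have ys : star y = y by rewrite starB star1 ws.
  have sy : s' * y = y * s'.
    by rewrite mulrBr mulrBl mulr1 mul1r wc // -exprS -exprSr.
  pose u := y + 'i%C *: s'.
  have su : star u = y - 'i%C *: s'.
    by rewrite (ustarD UN) ys (ustarZ UN) ss -scaleNr; congr (_ + _ *: _); apply/eqP; rewrite eq_complex /= oppr0 !eqxx.
  have uu : star u * u = 1.
    by rewrite su mul_conj_comm // -[y ^+ 2]/((1 - w) ^+ 2) wE subrK.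
  have Nu : N u = 1.
    have := unorm_star UN u; rewrite uu unorm1 => /esym/eqP.
    by rewrite sqrf_eq1 => /orP[/eqP//|/eqP u1]; have := unorm_ge0 u; rewrite u1; lra.
  have y2 : 2%:C *: y = u + star u.
    by rewrite su addrACA subrr addr0 -[2]/(1 + 1) rmorphD scalerDl scale1r.
  have := unormD UN u (star u); rewrite -y2 unorm_starE Nu unormZr // => y1.
  by rewrite unorm_sqr_sa // expr_le1 ?unorm_ge0 //; lra.
move=> ss sm; apply/ler_addgt0Pr => e e0.
have e2 : 0 < e / 2 by rewrite divr_gt0.
have me : 0 < m + e / 2 by rewrite ltr_wpDl // (le_trans _ sm) ?sqr_ge0.
(* The slack [e / 2] makes [N s < r] strict, so that [s / r] falls under [unit]. *)
pose r := Num.sqrt (m + e / 2).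
have r0 : 0 < r by rewrite sqrtr_gt0.
have rr : r ^+ 2 = m + e / 2 by rewrite sqr_sqrtr // ltW.
have sr : N s < r.
  by rewrite -(@ltr_pXn2r _ 2) ?nnegrE ?unorm_ge0 ?ltW // rr; lra.
have rV : 0 <= r^-1 by rewrite invr_ge0 ltW.
have := unit (r^-1%:C *: s); rewrite starZr ss (unormZr _ rV).
rewrite mulrC ltr_pdivrMr // mul1r => /(_ erefl sr).
rewrite -(ler_pM2l me) mulr1 -(unormZr _ (ltW me)) scalerBr exprZn -rmorphXn scalerA -rmorphM /=.
rewrite exprVn rr mulfV ?gt_eqF // scale1r => h.
have -> : m%:U - s ^+ 2 = (m + e / 2)%:U - s ^+ 2 - (e / 2)%:U.
  by rewrite rmorphD scalerDl addrAC addrK.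
have := unormB ((m + e / 2)%:U - s ^+ 2) (e / 2)%:U; rewrite unormU; lra.
Qed.

(** The C*-identity gives equality at the exponents [2 ^ j]; the others follow by factoring
    [z ^+ (2 ^ n)] as [z ^+ n] times a power whose norm is bounded submultiplicatively. *)
Lemma unorm_pow_sa z n : star z = z -> N z ^+ n <= N (z ^+ n).
Proof.
move=> zs.
have pow2 j : N (z ^+ (2 ^ j)) = N z ^+ (2 ^ j).
  elim: j => [|j IH]; first by rewrite expn0 !expr1.
  by rewrite expnSr !exprM unorm_sqr_sa ?starX ?zs // IH.
have up m : N (z ^+ m) <= N z ^+ m.
  elim: m => [|m IH]; first by rewrite !expr0 unorm1.
  by rewrite !exprS (le_trans (unormM UN _ _)) // ler_wpM2l ?unorm_ge0.
have [z0|z0] := eqVneq (N z) 0.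
  by case: n => [|n]; rewrite ?expr0 ?unorm1 // z0 expr0n unorm_ge0.
have zp : 0 < N z by rewrite lt_def z0 unorm_ge0.
have n2 : (n <= 2 ^ n)%N by rewrite ltnW // ltn_expl.
rewrite -(ler_pM2r (exprn_gt0 (2 ^ n - n) zp)) -exprD subnKC // -pow2.
rewrite -{1}(subnKC n2) exprD (le_trans (unormM UN _ _)) //.
by rewrite ler_wpM2l ?unorm_ge0.
Qed.

(* Self-adjoint with nonnegative spectrum, in terms of the norm alone. *)
Definition psd k : Prop := star k = k /\ exists2 l, 0 <= l & N (l%:U - k) <= l.

Lemma psdD k1 k2 : psd k1 -> psd k2 -> psd (k1 + k2).
Proof.
move=> [s1 [l1 l10 h1]] [s2 [l2 l20 h2]]; split; first by rewrite (ustarD UN) s1 s2.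
exists (l1 + l2); first exact: addr_ge0.
rewrite rmorphD scalerDl opprD addrACA; have := unormD UN (l1%:U - k1) (l2%:U - k2); lra.
Qed.

Lemma psdZ c k : 0 <= c -> psd k -> psd (c%:C *: k).
Proof.
move=> c0 [s1 [l l0 h]]; split; first by rewrite starZr s1.
exists (c * l); first exact: mulr_ge0.
by rewrite rmorphM -scalerA -scalerBr unormZr // ler_wpM2l.
Qed.

Lemma psd_scalar c : 0 <= c -> psd c%:U.
Proof.
move=> c0; split; first by rewrite starZr star1.
by exists c; rewrite // subrr unorm0.
Qed.

Lemma psd_sqr s : star s = s -> psd (s ^+ 2).
Proof.
move=> ss; split; first by rewrite starX ss.
by exists (N s ^+ 2); [exact: sqr_ge0|exact: unorm_sub_sqr].
Qed.

(** The inequality passes from the witness [l] to any bound [c] of the norm: up to a scalar, [k + d]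
    is the square of a self-adjoint element, to which [unorm_sub_sqr] applies, and [d] is
    arbitrarily small. *)
Lemma psd_norm k c : psd k -> N k <= c -> N (c%:U - k) <= c.
Proof.
move=> [ks [l l0 kl]] kc; apply/ler_addgt0Pr => e e0.
pose d := e / 2; have d0 : 0 < d by rewrite divr_gt0.
(* [L * z = l - k + d] has norm at most [l + d], strictly below [L], so [1 - z] has a square
   root. *)
pose L := l + 2 * d; have L0 : 0 < L by rewrite ltr_wpDl // mulr_gt0.
pose z := 1 - L^-1%:C *: (k + d%:U).
have ELz : L%:C *: z = l%:U - k + d%:U.
  have LE : L%:U = l%:U + d%:U + d%:U.
    by rewrite -!scalerDl -!rmorphD; congr (_%:C *: _); rewrite /L; lra.
  rewrite scalerBr scalerA -rmorphM mulfV ?gt_eqF // scale1r LE.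
  by rewrite opprD addrACA subrr addr0 addrAC.
have [||w [ws _ wE]] := @sqrt_one_sub z.
- by rewrite starB star1 starZr (ustarD UN) ks starZr star1.
- rewrite -(ltr_pM2l L0) -(unormZr _ (ltW L0)) ELz mulr1.
  by have := unormD UN (l%:U - k) d%:U; rewrite (unormU (ltW d0)) /L; lra.
have ys : star (1 - w) = 1 - w by rewrite starB star1 ws.
have kd : L%:C *: (1 - w) ^+ 2 = k + d%:U.
  by rewrite wE /z opprB addrC subrK scalerA -rmorphM mulfV ?gt_eqF // scale1r.
have Nk : N (k + d%:U) <= c + d by have := unormD UN k d%:U; rewrite (unormU (ltW d0)); lra.
have := @unorm_sub_sqr (1 - w) (L^-1 * (c + d)) ys.
rewrite -unorm_sqr_sa // -(ler_pM2l L0) mulrA mulfV ?gt_eqF // mul1r.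
rewrite -(unormZr _ (ltW L0)) kd => /(_ Nk).
rewrite -(ler_pM2l L0) mulrA mulfV ?gt_eqF // mul1r -(unormZr _ (ltW L0)) scalerBr kd.
rewrite scalerA -rmorphM mulrA mulfV ?gt_eqF // mul1r rmorphD scalerDl opprD addrACA subrr addr0.
by rewrite /d; lra.
Qed.

(** Twice this element is the sum of the squares of the self-adjoint [y + star y] and
    ['i (y - star y)]. It is thus positive before anything is known about [star y * y] alone. *)
Lemma psd_sumsq y : psd (y * star y + star y * y).
Proof.
pose a := y + star y; pose b := 'i%C *: (y - star y).
have as_ : star a = a by rewrite (ustarD UN) (ustarK UN) addrC.
have bs : star b = b.
  by rewrite (ustarZ UN) starB (ustarK UN) -opprB scalerN -scaleNr; congr (_ *: _); apply/eqP; rewrite eq_complex /= oppr0 opprK !eqxx.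
have E : a ^+ 2 + b ^+ 2 = 2%:C *: (y * star y + star y * y).
  rewrite exprZn sqr_i scaleN1r !expr2 !mulrDr !mulrDl !mulNr !mulrN opprK !opprD !opprK.
  rewrite -[2]/(1 + 1 : R) rmorphD scalerDl scale1r.
  set p := y * y; set q := star y * y; set r := y * star y; set t := star y * star y.
  rewrite -[p + q + (r + t)]addrA [q + (r + t)]addrA -[- p + _ + _]addrA.
  rewrite [q + (_ - _)]addrA addrACA subrr add0r [q + r + t]addrC -addrA.
  by rewrite addrC -addrA subrK [q + r]addrC.
have := psdZ (_ : 0 <= 2^-1) (psdD (psd_sqr as_) (psd_sqr bs)).
rewrite E scalerA -rmorphM mulVf // scale1r; apply.
by rewrite invr_ge0.
Qed.

Lemma cmod4 : cmod (4 : R[i]) = 4.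
Proof. by rewrite -(rmorph_nat (real_complex R)) cmod_real ger0_norm. Qed.

(** Both [1 + 'i s] and [1 - 'i s] have norm squared [N (1 + s ^+ 2)], while the difference of their
    squares, [4 'i s], has norm 4. *)
Lemma unorm_add_sqr s : star s = s -> N s = 1 -> 2 <= N (1 + s ^+ 2).
Proof.
move=> ss s1; pose t := 'i%C *: s; pose a := 1 + t; pose b := 1 - t.
have sa : star a = b.
  rewrite (ustarD UN) star1 (ustarZ UN) ss /b /t -scaleNr; congr (_ + _ *: _).
  by apply/eqP; rewrite eq_complex /= oppr0 !eqxx.
have ba : b * a = 1 + s ^+ 2 by rewrite mul_conj_comm ?expr1n // mulr1 mul1r.
have Na : N a ^+ 2 = N (1 + s ^+ 2) by rewrite -(unorm_star UN) sa ba.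
have Nb : N b = N a by rewrite -sa unorm_starE.
have E : a ^+ 2 - b ^+ 2 = 4 *: t.
  have := congr1 (horner_alg t) (_ : (1 + 'X) ^+ 2 - (1 - 'X) ^+ 2 = 4%:R * 'X).
  rewrite !(rmorphB, rmorphXn, rmorphD, rmorphM, rmorph1, rmorph_nat) /= !horner_algX.
  by move=> -> //; [rewrite mulr_natl -scaler_nat|ring].
have Nt : N (4 *: t) = 4 by rewrite !(unormZ UN) cmod4 cmodi s1 !mulr1.
have := unormB (a ^+ 2) (b ^+ 2); rewrite E Nt.
have := unormM UN a a; have := unormM UN b b; rewrite -!expr2 Nb Na; lra.
Qed.

(* Kaplansky: if [h = star y * y] were not positive, [z = 1 - h] would have norm
   [> 1], and the normalised [y * z ^+ n] would have [star v * v] almost negative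
   and hence [v * star v] almost positive, which contradicts the intertwining
   [v * p (star v * v) = p (v * star v) * v] for polynomials [p]. *)
Lemma star_mul_not_almost_neg v : N v = 1 -> psd ((2 / 5)%:U - star v * v) -> False.
Proof.
(* The contradiction at the end is [4 <= 2 * (e + 1) ^+ 2]; any nonnegative [e] below [sqrt 2 - 1]
   would do. *)
move=> v1 psdu; pose e : R := 2 / 5.
pose u := star v * v; pose r := v * star v.
have e0 : 0 <= e by rewrite /e; lra.
have Nu : N u = 1 by rewrite (unorm_star UN) v1 expr1n.
have Nr : N r = 1.
  by rewrite /r -{1}(ustarK UN v) (unorm_star UN) unorm_starE v1 expr1n.
have rs : star r = r by rewrite (ustarM UN) (ustarK UN).
have e1 : 0 <= e + 1 by rewrite addr_ge0.
have big k : N k = 1 -> psd (e%:U + k) -> N (1 - k) <= e + 1.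
  move=> Nk pk; have -> : 1 - k = (e + 1)%:U - (e%:U + k).
    by rewrite rmorphD scalerDl scale1r opprD addrACA subrr add0r.
  apply: psd_norm => //.
  by have := unormD UN e%:U k; rewrite unormU // Nk.
have N1u : N (1 + u) <= e + 1.
  by have := big (- u); rewrite unormN opprK; apply.
have psdr : psd (e%:U + r).
  (* Adding the positive [v * star v + star v * v] trades the bound on [star v * v] for one on
     [v * star v]. *)
  have := psdD psdu (psd_sumsq v); rewrite -/u -/r addrACA addNr addr0.
  by [].
have N1r := big r Nr psdr.
have vu : v * (1 + u) = (1 + r) * v by rewrite mulrDr mulrDl mulr1 mul1r mulrA.
have E1 : v * ((1 + u) * (1 + u)) * star v = (1 + r) ^+ 2 * r.
  by rewrite mulrA vu -[_ * v * _]mulrA vu /r !mulrA expr2.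
have le1 : N ((1 + r) ^+ 2 * r) <= (e + 1) ^+ 2.
  rewrite -E1; apply: le_trans (unormM UN _ _) _.
  rewrite unorm_starE v1 mulr1; apply: le_trans (unormM UN _ _) _.
  by rewrite v1 mul1r (le_trans (unormM UN _ _)) // expr2 ler_pM ?unorm_ge0.
have le2 : N ((1 - r) ^+ 2 * r) <= (e + 1) ^+ 2.
  apply: le_trans (unormM UN _ _) _; rewrite Nr mulr1 expr2.
  by rewrite (le_trans (unormM UN _ _)) // expr2 ler_pM ?unorm_ge0.
have E2 : (1 + r) ^+ 2 * r - (1 - r) ^+ 2 * r = 4 *: r ^+ 2.
  have := congr1 (horner_alg r) (_ : (1 + 'X) ^+ 2 * 'X - (1 - 'X) ^+ 2 * 'X = 4%:R * 'X ^+ 2).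
  rewrite !(rmorphB, rmorphXn, rmorphD, rmorphM, rmorph1, rmorph_nat) /= !horner_algX.
  by move=> -> //; [rewrite mulr_natl -scaler_nat|ring].
have := unormB ((1 + r) ^+ 2 * r) ((1 - r) ^+ 2 * r).
rewrite E2 (unormZ UN) cmod4 unorm_sqr_sa // Nr expr1n mulr1.
move: le1 le2; rewrite /e; lra.
Qed.

Lemma psd_star_mul x : psd (star x * x).
Proof.
pose c0 := (N x + 1)^-1; have x1 : 0 < N x + 1 by rewrite ltr_wpDl ?unorm_ge0.
have c00 : 0 < c0 by rewrite invr_gt0.
suff small y : N y < 1 -> psd (star y * y).
  have Ny : N (c0%:C *: x) < 1.
    by rewrite (unormZr _ (ltW c00)) mulrC ltr_pdivrMr // mul1r ltrDl.
  have := psdZ (sqr_ge0 (N x + 1)) (small _ Ny).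
  rewrite starZr -scalerAl -scalerAr !scalerA -!rmorphM.
  by rewrite -mulrA -expr2 -exprMn mulfV ?gt_eqF // expr1n scale1r.
move=> {x c0 x1 c00} Ny; pose h := star y * y.
have hs : star h = h by rewrite (ustarM UN) (ustarK UN).
have Nh : N h < 1 by rewrite (unorm_star UN) expr_lt1 ?unorm_ge0.
have [//|hneg] := pselect (psd h); exfalso.
have [z zE] : exists z, z = 1 - h by exists (1 - h).
have zs : star z = z by rewrite zE starB star1 hs.
have hz : h = 1 - z by rewrite zE subKr.
have z1 : 1 < N z.
  rewrite ltNge; apply/negP => z1; apply: hneg; split=> //.
  by exists 1; rewrite ?ler01 // scale1r -zE.
have [w [ws _ wE]] := sqrt_one_sub hs Nh.
(* The reduction to [N y < 1] provides this self-adjoint root of [z], which turns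
   [z ^+ m * (1 - z) ^+ 2] into a square. *)
have [sg [sgs sgz]] : exists sg, star sg = sg /\ sg ^+ 2 = z.
  by exists (1 - w); rewrite starB star1 ws zE.
have psdz : psd z by rewrite -sgz; exact: psd_sqr.
(* In the order given by [psd] this is [z ^+ m * (1 - z) <= 1]; the inductive step adds the square
   of [sg ^+ m * (1 - z)]. *)
have T m : psd (1 - z ^+ m + z ^+ m.+1).
  elim: m => [|m IH]; first by rewrite expr0 subrr add0r expr1.
  have zc : sg ^+ m * (1 - z) = (1 - z) * sg ^+ m.
    by rewrite mulrBr mulrBl mulr1 mul1r -sgz -!exprD addnC.
  have sq : star (sg ^+ m * (1 - z)) = sg ^+ m * (1 - z).
    by rewrite (ustarM UN) starX sgs starB star1 zs -zc.
  have := psdD IH (psd_sqr sq).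
  rewrite exprMn_comm // -exprM mulnC exprM sgz.
  congr (psd _).
  have := congr1 (horner_alg z) (_ : 1 - 'X ^+ m + 'X ^+ m.+1 + 'X ^+ m * (1 - 'X) ^+ 2 = 1 - 'X ^+ m.+1 + 'X ^+ m.+2).
  rewrite !(rmorphB, rmorphXn, rmorphD, rmorphM, rmorph1) /= !horner_algX.
  by move=> -> //; rewrite !exprS; ring.
pose mu := N z - 1; have mu0 : 0 < mu by rewrite subr_gt0.
have zmu : N z = 1 + mu by rewrite /mu; lra.
(* [5 / 2] is the inverse of [2 / 5]: [T] gives [star v * v >=] nothing below but [star v * v <= 1],
   and division by [N v ^+ 2 >= 5 / 2] turns that 1 into at most [2 / 5]. *)
have [n hn] := bernoulli_unbounded (5 / 2) mu0.
have mun : 0 < 1 + mu by rewrite addr_gt0.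
pose v := y * z ^+ n.
have vv : star v * v = z ^+ (2 * n) - z ^+ (2 * n).+1.
  rewrite (ustarM UN) starX zs !mulrA -[_ * star y * y]mulrA -/h hz.
  rewrite mulrBr mulr1 mulrBl -exprSr -!exprD; congr (_ ^+ _ - _ ^+ _).
    by rewrite mul2n addnn.
  by rewrite addSn addnn mul2n.
pose c := N v ^+ 2.
have cE : c = N (z ^+ (2 * n) - z ^+ (2 * n).+1) by rewrite -vv (unorm_star UN).
have cge : 5 / 2 <= c.
  have := unorm_pow_sa (2 * n).+1 zs.
  have up : N (z ^+ (2 * n)) <= N z ^+ (2 * n).
    elim: (2 * n)%N => [|m IH]; first by rewrite !expr0 unorm1.
    by rewrite !exprS (le_trans (unormM UN _ _)) // ler_wpM2l ?unorm_ge0.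
  have := unormB (z ^+ (2 * n) - z ^+ (2 * n).+1) (z ^+ (2 * n)).
  rewrite addrAC subrr add0r unormN -cE.
  have : (1 + mu) ^+ n <= (1 + mu) ^+ (2 * n).
    by rewrite ler_weXn2l ?leq_pmull // lerDl ltW.
  move: up; rewrite zmu [(1 + mu) ^+ _.+1]exprS mulrDl mul1r => up h1.
  have : mu * (1 + mu) ^+ n <= mu * (1 + mu) ^+ (2 * n) by rewrite ler_pM2l.
  move: up hn; lra.
have Nv0 : 0 < N v.
  rewrite lt_def unorm_ge0 andbT; apply/eqP => v0.
  by move: cge; rewrite /c v0 expr0n /=; lra.
have Nvi : 0 <= (N v)^-1 by rewrite invr_ge0 ltW.
apply: (@star_mul_not_almost_neg ((N v)^-1%:C *: v)).
  by rewrite unormZr // mulVf ?gt_eqF.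
rewrite starZr -scalerAl -scalerAr scalerA -rmorphM -invfM -expr2 -/c vv.
have c0 : 0 < c by rewrite exprn_gt0.
have ci : 0 <= c^-1 by rewrite invr_ge0 ltW.
have ci2 : 0 <= 2 / 5 - c^-1.
  by rewrite subr_ge0 -[2 / 5]invrK lef_pV2 ?posrE // invf_div; lra.
have := psdD (psdZ ci (T (2 * n)%N)) (psd_scalar ci2).
congr (psd _); rewrite rmorphB scalerBl addrC -addrA; congr (_ + _).
rewrite addrC -scalerBr -scalerN opprB; congr (_ *: _).
by rewrite addrAC [1 - _ - 1]addrAC subrr add0r addrC.
Qed.

(** Hahn-Banach is applied at [1 + s ^+ 2], of norm at least 2: the real parts at [1] and at
    [s ^+ 2] are each at most 1, so both equal 1. One functional thus norms [s ^+ 2] and is unital,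
    and unital of norm one implies positive. *)
Theorem norming_state s : star s = s -> N s = 1 -> exists phi : U -> R[i],
  [/\ scalar phi, (forall x, cmod (phi x) <= N x),
      (forall x, 0 <= phi (star x * x)) & phi (s ^+ 2) = 1].
Proof.
move=> ss s1.
have [phi [phl phN ph0]] := complex_hahn_banach (1 + s ^+ 2) (unormD UN) unormZr.
have phc x : cmod (phi x) <= N x.
  have [c c1 cx] := rotate_cmod (phi x).
  have := phN (c *: x); rewrite (unormZ UN) c1 mul1r.
  by rewrite (linZ (W := R[i]^o) phl) /GRing.scale /= cx.
have phD x y : phi (x + y) = phi x + phi y := linD (W := R[i]^o) phl x y.
have phB x y : phi (x - y) = phi x - phi y := linB (W := R[i]^o) phl x y.
have phZ (c : R[i]) x : phi (c *: x) = c * phi x := linZ (W := R[i]^o) phl c x.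
have Ns2 : N (s ^+ 2) = 1 by rewrite unorm_sqr_sa // s1 expr1n.
have unit x : N x = 1 -> complex.Re (phi x) = 1 -> phi x = 1.
  move=> Nx re; have := phc x; rewrite Nx => cx.
  have : cmod (phi x) ^+ 2 <= 1 by rewrite expr_le1 ?cmod_ge0.
  rewrite cmod_sqr re expr1n gerDl => im.
  have /eqP : complex.Im (phi x) ^+ 2 = 0 by apply/eqP; rewrite eq_le im sqr_ge0.
  rewrite sqrf_eq0 => /eqP im0.
  by apply/eqP; rewrite eq_complex re im0 !eqxx.
have R1 := phN 1; have R2 := phN (s ^+ 2); rewrite unorm1 in R1; rewrite Ns2 in R2.
have R3 := unorm_add_sqr ss s1.
have R4 : complex.Re (phi 1) + complex.Re (phi (s ^+ 2)) = N (1 + s ^+ 2).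
  by rewrite -ph0 phD; case: (phi 1) (phi (s ^+ 2)) => ? ? [].
have ph1 : phi 1 = 1 by apply: unit; [exact: unorm1|lra].
exists phi; split=> //; last by apply: unit => //; lra.
move=> x; have [ks [l l0 kl]] := psd_star_mul x.
move: (star x * x) ks kl => k ks kl.
(* The norm squared of [k + 'i t] is at most [N k ^+ 2 + t ^+ 2]. A nonzero imaginary part [b]
   violates the resulting bound at the [t] with [b * t = N k ^+ 2]. *)
have im t : (complex.Im (phi k) + t) ^+ 2 <= N k ^+ 2 + t ^+ 2.
  pose kt := k + 'i%C *: t%:U.
  have skt : star kt = k - 'i%C *: t%:U.
    rewrite (ustarD UN) (ustarZ UN) starZr star1 ks /kt -scaleNr; congr (_ + _ *: _).
    by apply/eqP; rewrite eq_complex /= oppr0 !eqxx.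
  have : N kt ^+ 2 <= N k ^+ 2 + t ^+ 2.
    rewrite -(unorm_star UN) skt mul_conj_comm.
      apply: le_trans (unormD UN _ _) _; rewrite lerD //.
        by rewrite unorm_sqr_sa.
      by rewrite exprZn expr1n -rmorphXn unormZr ?sqr_ge0 // unorm1 mulr1.
    by rewrite -scalerAr -scalerAl mulr1 mul1r.
  apply: le_trans; have := phc kt.
  rewrite -(@ler_pXn2r _ 2) ?nnegrE ?cmod_ge0 ?unorm_ge0 //; apply: le_trans.
  rewrite cmod_sqr phD !phZ ph1 mulr1; case: (phi k) => a b /=.
  by rewrite !(mul0r, mulr0, sub0r, mul1r, add0r, subr0, addr0) lerDr sqr_ge0.
have im0 : complex.Im (phi k) = 0.
  apply/eqP; apply/negPn/negP => b0.
  set b := complex.Im (phi k) in im b0.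
  have [t bt] : exists t, b * t = N k ^+ 2 by exists (N k ^+ 2 / b); rewrite mulrC divfK.
  have := im t; rewrite sqrrD bt.
  have : 0 < b ^+ 2 by rewrite lt_def sqrf_eq0 b0 sqr_ge0.
  have := sqr_ge0 (N k); rewrite mulr2n; lra.
rewrite lecE im0 eqxx /=.
(* The real part of [phi (l - k)] is at most [l], and [phi 1 = 1]. *)
have := phN (l%:C *: 1 - k); rewrite phB phZ ph1 mulr1.
by case: (phi k) => a b /=; lra.
Qed.
End UnitalCStar.

(** * Unitization and states *)

Section OpNorm.
Context {R : realType} {V W : normedModType R[i]} (f : V -> W).
Hypothesis fl : linear f.

Lemma opnorm_le (C : R) : 0 <= C -> (forall x, rnorm (f x) <= C * rnorm x) -> opnorm f <= C.
Proof.
move=> C0 fC; apply: ge_sup; first by exists (rnorm (f 0)), 0 => //=; rewrite rnorm0.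
by move=> _ [x /= x1 <-]; apply: le_trans (fC x) _; rewrite ler_piMr.
Qed.

(** Some bound [C] has to be supplied, since the supremum defaults to [0] for an unbounded map. *)
Lemma rnorm_le_opnorm (C : R) : (forall x, rnorm (f x) <= C * rnorm x) ->
  forall x, rnorm (f x) <= opnorm f * rnorm x.
Proof.
move=> fC x; have [->|x0] := eqVneq x 0; first by rewrite (lin0 fl) !rnorm0 mulr0.
have nx := rnorm_gt0 x0; have nxi : 0 <= (rnorm x)^-1 by rewrite invr_ge0 ltW.
rewrite -ler_pdivrMr // mulrC -[(rnorm x)^-1]ger0_norm // -cmod_real -rnormZ -(linZ fl).
apply: ub_le_sup; last first.
  by exists ((rnorm x)^-1%:C *: x); rewrite //= rnormZ cmod_real ger0_norm // mulVf ?gt_eqF.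
exists `|C| => _ [y /= y1 <-]; apply: le_trans (fC y) _.
apply: le_trans (_ : `|C| * rnorm y <= _); first by rewrite ler_wpM2r ?rnorm_ge0 ?ler_norm.
by rewrite ler_piMr.
Qed.

Lemma opnorm_ge0 : 0 <= opnorm f.
Proof.
rewrite /opnorm; set S := [set _ | _ in _].
have [hs|/sup_out -> //] := pselect (has_sup S).
apply: (@le_trans _ _ (rnorm (f 0))); first exact: rnorm_ge0.
by apply: ub_le_sup; [case: hs|exists 0 => //=; rewrite rnorm0].
Qed.

End OpNorm.

Section CStarNorm.
Context {R : realType} {A : cstarAlgType R}.
Implicit Types (a b x : A) (c : R[i]).

Lemma cmulDl a b x : cmul (a + b) x = cmul a x + cmul b x.
Proof. exact: (linD (cmul_linearl x)). Qed.
Lemma cmulDr a b x : cmul x (a + b) = cmul x a + cmul x b.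
Proof. exact: (linD (cmul_linearr x)). Qed.
Lemma cmulZl c a x : cmul (c *: a) x = c *: cmul a x.
Proof. exact: (linZ (cmul_linearl x)). Qed.
Lemma cmulZr c a x : cmul x (c *: a) = c *: cmul x a.
Proof. exact: (linZ (cmul_linearr x)). Qed.
Lemma cmul0 x : cmul x 0 = 0.
Proof. exact: (lin0 (cmul_linearr x)). Qed.
Lemma c0mul x : cmul 0 x = 0.
Proof. exact: (lin0 (cmul_linearl x)). Qed.

Lemma cstarD a b : cstar (a + b) = cstar a + cstar b.
Proof. by rewrite -{1}(scale1r a) cstar_antilinear rmorph1 scale1r. Qed.
Lemma cstar0 : cstar (0 : A) = 0.
Proof. by apply: (addrI (cstar 0)); rewrite -cstarD !addr0. Qed.
Lemma cstarZ c a : cstar (c *: a) = c^*%C *: cstar a.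
Proof. by rewrite -[c *: a]addr0 cstar_antilinear cstar0 addr0. Qed.

Lemma rnormM a b : rnorm (cmul a b) <= rnorm a * rnorm b.
Proof. by rewrite -lecR rmorphM /= -!rnormE cnormM. Qed.

Lemma rnorm_star_mul a : rnorm (cmul (cstar a) a) = rnorm a ^+ 2.
Proof. by apply: complexI; rewrite rmorphXn /= -!rnormE cnorm_star. Qed.

Lemma rnorm_cstar a : rnorm (cstar a) = rnorm a.
Proof.
have le b : rnorm b <= rnorm (cstar b).
  have [->|b0] := eqVneq b 0; first by rewrite cstar0.
  by rewrite -(ler_pM2r (rnorm_gt0 b0)) -expr2 -rnorm_star_mul rnormM.
by apply/eqP; rewrite eq_le le -{2}(cstarK a) le.
Qed.

End CStarNorm.

Definition unitization (R : realType) (A : cstarAlgType R) : Type := (R[i]^o * A)%type.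

Section Unitization.
Context {R : realType} {A : cstarAlgType R}.
Local Notation U := (unitization A).
Implicit Types (u v : U) (a b x : A) (c : R[i]).

HB.instance Definition _ := GRing.Lmodule.copy U (R[i]^o * A)%type.

Definition unit_mul u v : U :=
  (u.1 * v.1, u.1 *: v.2 + v.1 *: u.2 + cmul u.2 v.2).

Let unit_one : U := (1, 0).

Let unit_mulA : associative unit_mul.
Proof.
move=> [k a] [l b] [m c]; rewrite /unit_mul /=; congr pair; first exact: mulrA.
rewrite !scalerDr !scalerA !cmulDl !cmulDr !cmulZl !cmulZr cmulA.
rewrite [m * k]mulrC [m * l]mulrC -!addrA; congr (_ + _); congr (_ + _).
by rewrite addrCA; congr (_ + _); rewrite [RHS]addrCA; congr (_ + _); rewrite addrCA.
Qed.

Let unit_mul1 : left_id unit_one unit_mul.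
Proof. by move=> [k a]; rewrite /unit_mul /= mul1r scale1r scaler0 c0mul !addr0. Qed.

Let unit_1mul : right_id unit_one unit_mul.
Proof. by move=> [k a]; rewrite /unit_mul /= mulr1 scale1r scaler0 cmul0 add0r addr0. Qed.

Let unit_mulDl : left_distributive unit_mul +%R.
Proof.
move=> [k a] [l b] [m c]; apply: injective_projections => /=; first exact: mulrDl.
rewrite scalerDl scalerDr cmulDl -!addrA; congr (_ + _).
by rewrite addrCA; congr (_ + _); rewrite [RHS]addrCA; congr (_ + _); rewrite addrCA.
Qed.

Let unit_mulDr : right_distributive unit_mul +%R.
Proof.
move=> [k a] [l b] [m c]; apply: injective_projections => /=; first exact: mulrDr.
rewrite scalerDl scalerDr cmulDr -!addrA; congr (_ + _).
by rewrite addrCA; congr (_ + _); rewrite [RHS]addrCA; congr (_ + _); rewrite addrCA.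
Qed.

Let unit_one_neq0 : unit_one != 0.
Proof. by apply/eqP => -[/eqP]; rewrite oner_eq0. Qed.

HB.instance Definition _ := GRing.Zmodule_isNzRing.Build U
  unit_mulA unit_mul1 unit_1mul unit_mulDl unit_mulDr unit_one_neq0.

Let unit_scaleAl c u v : c *: (u * v) = (c *: u) * v.
Proof.
case: u v => [k a] [l b]; congr pair => /=; first exact: mulrA.
by rewrite !scalerDr !scalerA cmulZl [c * l]mulrC.
Qed.

HB.instance Definition _ := GRing.Lmodule_isLalgebra.Build R[i] U unit_scaleAl.

Let unit_scaleAr c u v : c *: (u * v) = u * (c *: v).
Proof.
case: u v => [k a] [l b]; congr pair => /=; first exact: mulrCA.
by rewrite !scalerDr !scalerA cmulZr [c * k]mulrC.
Qed.

HB.instance Definition _ := GRing.Lalgebra_isAlgebra.Build R[i] U unit_scaleAr.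

Definition unit_star u : U := (u.1^*%C, cstar u.2).

Definition unit_act u x : A := u.1 *: x + cmul u.2 x.

(** The operator norm of the left action alone is not definite if [A] already has a unit [e]: the
    pair [(1, - e)] acts as zero. The maximum with the modulus of the scalar part is definite and
    keeps the C*-identity. *)
Definition unit_norm u : R := Num.max (cmod u.1) (opnorm (unit_act u)).

Definition unit_emb a : U := (0, a).

Lemma unit_act_linear u : linear (unit_act u).
Proof.
move=> c x y; rewrite /unit_act cmulDr cmulZr !scalerDr !scalerA mulrC addrACA.
by rewrite -!scalerA.
Qed.

Lemma unit_act_bound u x : rnorm (unit_act u x) <= (cmod u.1 + rnorm u.2) * rnorm x.
Proof.
by rewrite mulrDl -rnormZ (le_trans (rnormD _ _)) // lerD2l rnormM.
Qed.

Let act_le u x : rnorm (unit_act u x) <= opnorm (unit_act u) * rnorm x.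
Proof. exact: (rnorm_le_opnorm (unit_act_linear u) (unit_act_bound u)). Qed.

Let act_ge0 u : 0 <= opnorm (unit_act u).
Proof. exact: opnorm_ge0. Qed.

Lemma unit_actM u v x : unit_act (u * v) x = unit_act u (unit_act v x).
Proof.
rewrite /unit_act /= !cmulDl !cmulZl !scalerDr !scalerA cmulDr cmulZr cmulA.
by rewrite -!addrA.
Qed.

(** For the [A]-valued inner product [cmul (cstar x) y] this says that [unit_star u] acts as the
    adjoint of [u]; the C*-identity of the operator norm rests on it. *)
Lemma unit_act_star u x :
  cmul (cstar (unit_act u x)) (unit_act u x) = cmul (cstar x) (unit_act (unit_star u * u) x).
Proof.
rewrite unit_actM /unit_act /= cstarD cstarZ cstarM cmulDl cmulZl -cmulA.
by rewrite -cmulZr -cmulDr.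
Qed.

Lemma unit_starM u v : unit_star (u * v) = unit_star v * unit_star u.
Proof.
apply: injective_projections => /=; first by rewrite rmorphM mulrC.
by rewrite !cstarD !cstarZ cstarM [_ *: _ + _ *: _]addrC.
Qed.

Let opnormM u v : opnorm (unit_act (u * v)) <= opnorm (unit_act u) * opnorm (unit_act v).
Proof.
apply: opnorm_le => [|x]; first by rewrite mulr_ge0.
rewrite unit_actM -mulrA (le_trans (act_le _ _)) // ler_wpM2l //.
Qed.

Let opnorm_star_mul u :
  opnorm (unit_act (unit_star u * u)) = opnorm (unit_act u) ^+ 2.
Proof.
have le v : opnorm (unit_act v) ^+ 2 <= opnorm (unit_act (unit_star v * v)).
  set t := opnorm (unit_act (_ * _)).
  have t0 : 0 <= t := act_ge0 _.
  rewrite -(sqr_sqrtr t0) ler_pXn2r ?nnegrE ?sqrtr_ge0 //.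
  apply: opnorm_le => [|x]; first exact: sqrtr_ge0.
  rewrite -(@ler_pXn2r _ 2) ?nnegrE ?rnorm_ge0 ?mulr_ge0 ?sqrtr_ge0 ?rnorm_ge0 //.
  rewrite exprMn sqr_sqrtr // -rnorm_star_mul unit_act_star.
  rewrite (le_trans (rnormM _ _)) // rnorm_cstar expr2 mulrCA.
  by rewrite ler_wpM2l ?rnorm_ge0 // act_le.
have le2 v : opnorm (unit_act v) <= opnorm (unit_act (unit_star v)).
  have [->|v0] := eqVneq (opnorm (unit_act v)) 0; first exact: act_ge0.
  have vp : 0 < opnorm (unit_act v) by rewrite lt_def v0 act_ge0.
  by rewrite -(ler_pM2r vp) -expr2 (le_trans (le v)) // opnormM.
apply/eqP; rewrite eq_le le andbT (le_trans (opnormM _ _)) // expr2 ler_wpM2r //.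
have := le2 (unit_star u); rewrite /unit_star /= conjcK cstarK.
by case: (u).
Qed.

(** The lower bound comes from the action on [cstar a]. *)
Lemma unit_norm_emb a : unit_norm (unit_emb a) = rnorm a.
Proof.
rewrite /unit_norm /= cmod0 max_r //.
apply/eqP; rewrite eq_le; apply/andP; split.
  apply: opnorm_le => [|x]; first exact: rnorm_ge0.
  by rewrite /unit_act /= scale0r add0r rnormM.
have [->|a0] := eqVneq a 0; first by rewrite rnorm0 act_ge0.
have := act_le (unit_emb a) (cstar a).
rewrite /unit_act /= scale0r add0r -{1}(cstarK a) rnorm_star_mul rnorm_cstar expr2.
by rewrite ler_pM2r ?rnorm_gt0.
Qed.

Lemma real_complete (r : nat -> R) :
  (forall e : R, 0 < e ->
     exists n0, forall m n, (n0 <= m)%N -> (n0 <= n)%N -> `|r m - r n| < e) ->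
  exists l, forall e : R, 0 < e -> exists n0, forall n, (n0 <= n)%N -> `|r n - l| < e.
Proof.
move=> rC.
have /cauchy_cvgP/cvg_ex[l rl] : cauchy ((r : nat -> R^o) @ \oo).
  apply: cauchy_exP => e e0; have [n0 h] := rC e e0.
  exists (r n0), n0 => // n /= n0n.
  by rewrite -ball_normE /=; apply: h.
exists l => e e0; move: rl => /cvgrPdist_lt/(_ e e0)[n0 _ h].
by exists n0 => n /h /=; rewrite distrC.
Qed.

Lemma complex_complete (c : nat -> R[i]) :
  (forall e : R, 0 < e ->
     exists n0, forall m n, (n0 <= m)%N -> (n0 <= n)%N -> cmod (c m - c n) < e) ->
  exists l, forall e : R, 0 < e -> exists n0, forall n, (n0 <= n)%N -> cmod (c n - l) < e.
Proof.
move=> cC.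
have abs (z : R[i]) : `|complex.Re z| <= cmod z /\ `|complex.Im z| <= cmod z.
  split; first by rewrite -lecR -cmodE normc_ge_Re.
  rewrite -(@ler_pXn2r _ 2) ?nnegrE ?cmod_ge0 //.
  by rewrite cmod_sqr real_normK ?num_real // lerDr sqr_ge0.
have [|a ha] := @real_complete (fun n => complex.Re (c n)).
  move=> e /cC[n0 h]; exists n0 => m n mn nn; apply: le_lt_trans (h m n mn nn).
  by have [+ _] := abs (c m - c n); case: (c m) (c n) => ? ? [].
have [|b hb] := @real_complete (fun n => complex.Im (c n)).
  move=> e /cC[n0 h]; exists n0 => m n mn nn; apply: le_lt_trans (h m n mn nn).
  by have [_] := abs (c m - c n); case: (c m) (c n) => ? ? [].
exists (a +i* b) => e e0; have e2 : 0 < e / 2 by rewrite divr_gt0.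
have [n1 h1] := ha _ e2; have [n2 h2] := hb _ e2.
exists (maxn n1 n2) => n; rewrite geq_max => /andP[/h1 + /h2].
have := cmod_le_ReIm (c n - a +i* b); case: (c n) => x y /=; lra.
Qed.

Lemma unit_cstar_norm : cstar_norm unit_star unit_norm.
Proof.
have oD u v : opnorm (unit_act (u + v)) <= opnorm (unit_act u) + opnorm (unit_act v).
  apply: opnorm_le => [|x]; first by rewrite addr_ge0.
  have -> : unit_act (u + v) x = unit_act u x + unit_act v x.
    by rewrite /unit_act /= scalerDl cmulDl addrACA.
  by rewrite mulrDl (le_trans (rnormD _ _)) // lerD.
have oZ c u : opnorm (unit_act (c *: u)) <= cmod c * opnorm (unit_act u).
  apply: opnorm_le => [|x]; first by rewrite mulr_ge0 ?cmod_ge0.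
  have -> : unit_act (c *: u) x = c *: unit_act u x.
    by rewrite /unit_act /= cmulZl scalerDr scalerA.
  by rewrite rnormZ -mulrA ler_wpM2l ?cmod_ge0.
have N2 u v : cmod u.1 <= unit_norm u /\ opnorm (unit_act u) <= unit_norm u.
  by rewrite /unit_norm !le_max !lexx orbT.
have nD u v : unit_norm (u + v) <= unit_norm u + unit_norm v.
  have [u1 u2] := N2 u u; have [v1 v2] := N2 v v.
  rewrite {1}/unit_norm ge_max; apply/andP; split.
    by rewrite (le_trans (cmodD _ _)) // lerD.
  by rewrite (le_trans (oD _ _)) // lerD.
have nZ c u : unit_norm (c *: u) = cmod c * unit_norm u.
  have le c' u' : unit_norm (c' *: u') <= cmod c' * unit_norm u'.
    have [u1 u2] := N2 u' u'.
    rewrite {1}/unit_norm ge_max; apply/andP; split.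
      by rewrite cmodM ler_wpM2l ?cmod_ge0.
    by rewrite (le_trans (oZ _ _)) // ler_wpM2l ?cmod_ge0.
  apply/eqP; rewrite eq_le le /=.
  have [->|c0] := eqVneq c 0.
    by rewrite cmod0 mul0r (le_trans (cmod_ge0 (0 *: u).1)) // (N2 (0 *: u) u).1.
  have cp : 0 < cmod c by rewrite lt_def cmod_ge0 andbT; apply: contra_neq c0; exact: cmod_eq0.
  rewrite -ler_pdivlMl //; have := le c^-1 (c *: u).
  rewrite scalerA mulVf // scale1r => /le_trans; apply.
  suff -> : cmod c^-1 = (cmod c)^-1 by [].
  by apply: (mulfI (lt0r_neq0 cp)); rewrite -cmodM !mulfV ?cmod1 // gt_eqF.
split.
- by move=> [c a]; rewrite /unit_star /= conjcK cstarK.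
- by move=> u v; apply: injective_projections; rewrite /= ?rmorphD ?cstarD.
- by move=> c u; apply: injective_projections; rewrite /= ?rmorphM ?cstarZ.
- exact: unit_starM.
- exact: nD.
- exact: nZ.
- move=> u v; have [u1 u2] := N2 u u; have [v1 v2] := N2 v v.
  rewrite {1}/unit_norm ge_max; apply/andP; split.
    by rewrite cmodM ler_pM ?cmod_ge0.
  by rewrite (le_trans (opnormM _ _)) // ler_pM.
- move=> u; rewrite /unit_norm opnorm_star_mul /= cmodM cmod_conj -expr2.
  have [le|/ltW le] := leP (cmod u.1) (opnorm (unit_act u)).
    by rewrite max_r // ler_pXn2r // nnegrE // cmod_ge0.
  by rewrite max_l // ler_pXn2r // nnegrE // cmod_ge0.
- move=> [c a] N0; have [u1 u2] := N2 (c, a) (c, a).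
  rewrite N0 /= in u1 u2.
  have c0 : c = 0 by apply: cmod_eq0; apply/eqP; rewrite eq_le u1 cmod_ge0.
  rewrite c0; congr pair; apply: rnorm_eq0; rewrite -unit_norm_emb /unit_emb -[X in (X, _)]c0.
  exact: N0.
move=> u uC.
have [|c hc] := @complex_complete (fun n => (u n).1).
  move=> e /uC[n0 h]; exists n0 => m n mn nn; apply: le_lt_trans (h m n mn nn).
  exact: (N2 (u m - u n) (u m)).1.

have n1 : unit_norm 1 <= 1.
  rewrite /unit_norm ge_max cmod1 lexx /=; apply: opnorm_le => // x.
  by rewrite /unit_act /= scale1r c0mul addr0 mul1r.
have [|a ha] := @rcomplete R A (fun n => (u n).2).
  move=> e e0; have e2 : 0 < e / 2 by rewrite divr_gt0.
  have [n0 h] := uC _ e2.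
  exists n0 => m n mn nn; have := h m n mn nn.
  set d := u m - u n; have [d1 _] := N2 d d.
  rewrite -unit_norm_emb.
  (* Removing the scalar part costs at most [cmod d.1], so the second components are Cauchy in
     [A]. *)
  have -> : unit_emb ((u m).2 - (u n).2) = d + (- d.1) *: 1.
    apply: injective_projections.
      by change (0 = d.1 + (- d.1) * 1); rewrite mulr1 subrr.
    change ((u m).2 - (u n).2 = (u m).2 - (u n).2 + (- d.1) *: (0 : A)).
    by rewrite scaler0 addr0.
  have := nD d ((- d.1) *: 1); rewrite nZ cmodN.
  have : cmod d.1 * unit_norm 1 <= cmod d.1 by rewrite ler_piMr ?cmod_ge0.
  lra.
exists (c, a) => e e0; have e2 : 0 < e / 2 by rewrite divr_gt0.
have [m1 h1] := hc _ e2; have [m2 h2] := ha _ e2.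
exists (maxn m1 m2) => n; rewrite geq_max => /andP[/h1 l1 /h2 l2].
apply: le_lt_trans (_ : cmod ((u n).1 - c) + rnorm ((u n).2 - a) < e); last by lra.
rewrite /unit_norm ge_max lerDl rnorm_ge0 /=; apply: opnorm_le => [|x].
  by rewrite addr_ge0 ?cmod_ge0 ?rnorm_ge0.
exact: unit_act_bound.
Qed.

(** A norming state of the unitization is restricted to [A]. The restriction keeps norm exactly one
    because its value at [cmul s s], an element of norm at most one, is 1. *)
Theorem state_norming a : cstar a = a -> a != 0 -> exists f : A -> R[i],
  [/\ state f, (forall x, cmod (f x) <= rnorm x) &
      f (cmul a a) = (rnorm a ^+ 2)%:C].
Proof.
move=> as_ a0; have na := rnorm_gt0 a0.
pose r := rnorm a; have ri : 0 <= r^-1 by rewrite invr_ge0 ltW.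
pose s := r^-1%:C *: a.
have ss : unit_star (unit_emb s) = unit_emb s.
  apply: injective_projections; first exact: conjc0.
  by rewrite /= cstarZ as_ conjc_real.
have ns : unit_norm (unit_emb s) = 1.
  by rewrite unit_norm_emb rnormZ cmod_real ger0_norm // mulVf ?gt_eqF.
have [phi [phl phN phP phs]] := norming_state unit_cstar_norm ss ns.
pose f x := phi (unit_emb x).
have fN x : cmod (f x) <= rnorm x by rewrite -unit_norm_emb; exact: phN.
have embM x y : unit_emb (cmul x y) = unit_emb x * unit_emb y.
  by rewrite /unit_emb; apply: injective_projections; rewrite /= ?mul0r // !scale0r !add0r.
have fs : f (cmul s s) = 1 by rewrite /f embM -expr2.
have fl : scalar f.
  move=> c x y; rewrite /f -phl; congr phi.
  by apply: injective_projections; rewrite /= ?addr0 // /GRing.scale /= mulr0.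
have f2 : f (cmul a a) = (r ^+ 2)%:C.
  have -> : cmul a a = (r ^+ 2)%:C *: cmul s s.
    rewrite cmulZl cmulZr !scalerA -!rmorphM /= -mulrA -invfM -expr2 mulfV ?scale1r //.
    by rewrite expf_eq0 gt_eqF.
  by rewrite (linZ (W := R[i]^o) fl) fs [LHS]mulr1.
exists f; split=> //; split=> //.
  move=> _ [b ->]; rewrite /f embM.
  have -> : unit_emb (cstar b) = unit_star (unit_emb b) by apply: injective_projections => //; exact/esym/conjc0.
  exact: phP.
have rn (z : R[i]) : rnorm (z : R[i]^o) = cmod z by [].
apply/eqP; rewrite eq_le; apply/andP; split.
  by apply: opnorm_le => // x; rewrite rn mul1r.
have := @rnorm_le_opnorm R A R[i]^o f fl 1.
have bd x : rnorm (f x : R[i]^o) <= 1 * rnorm x by rewrite rn mul1r.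
move=> /(_ bd (cmul s s)); rewrite rn fs cmod1.
have : rnorm (cmul s s) <= 1.
  by rewrite (le_trans (rnormM _ _)) // -unit_norm_emb ns mulr1.
move=> s1 /le_trans; apply; rewrite ler_piMr //.
exact: opnorm_ge0.
Qed.

End Unitization.

(** * Hilbert spaces *)

Section HilbertSpace.
Context {R : realType} {H : hilbertType R}.
Implicit Types (x y z : H) (c : R[i]) (S T : H -> H).

Lemma dotDl x y z : dotp (x + y) z = dotp x z + dotp y z.
Proof. exact: linearDl. Qed.
Lemma dotDr x y z : dotp z (x + y) = dotp z x + dotp z y.
Proof. exact: linearDr. Qed.
Lemma dotZl c x y : dotp (c *: x) y = c * dotp x y.
Proof. exact: linearZl_LR. Qed.
Lemma dotZr c x y : dotp x (c *: y) = c^*%C * dotp x y.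
Proof. exact: linearZr_LR. Qed.
Lemma dotNl x y : dotp (- x) y = - dotp x y.
Proof. exact: linearNl. Qed.
Lemma dotNr x y : dotp x (- y) = - dotp x y.
Proof. exact: linearNr. Qed.
Lemma dotBl x y z : dotp (x - y) z = dotp x z - dotp y z.
Proof. exact: linearBl. Qed.
Lemma dotBr x y z : dotp z (x - y) = dotp z x - dotp z y.
Proof. exact: linearBr. Qed.
Lemma dot0l x : dotp 0 x = 0 :> R[i].
Proof. exact: linear0l. Qed.
Lemma dot0r x : dotp x 0 = 0 :> R[i].
Proof. exact: linear0r. Qed.
Lemma dotC x y : dotp x y = (dotp y x)^*%C.
Proof. by rewrite hermC expr0 mul1r. Qed.
Lemma dotxx x : dotp x x = (rnorm x ^+ 2)%:C.
Proof. by rewrite dotpE rnormE rmorphXn. Qed.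

Lemma dot_nondeg x : (forall y, dotp y x = 0) -> x = 0.
Proof.
move=> /(_ x); rewrite dotxx => /complexI/eqP; rewrite sqrf_eq0 => /eqP.
exact: rnorm_eq0.
Qed.

Lemma dot_inj x y : (forall z, dotp z x = dotp z y) -> x = y.
Proof.
move=> E; apply/eqP; rewrite -subr_eq0; apply/eqP; apply: dot_nondeg => z.
by rewrite dotBr E subrr.
Qed.

Lemma rnorm_sqrD x y :
  rnorm (x + y) ^+ 2 = rnorm x ^+ 2 + 2 * complex.Re (dotp x y) + rnorm y ^+ 2.
Proof.
have := congr1 (@complex.Re R) (dotxx (x + y)).
rewrite dotDl !dotDr !dotxx [dotp y x]dotC.
by case: (dotp x y) => a b /= <-; ring.
Qed.

Lemma cauchy_schwarz x y : cmod (dotp x y) <= rnorm x * rnorm y.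
Proof.
have [c c1 cx] := rotate_cmod (dotp x y).
have [->|y0] := eqVneq y 0; first by rewrite dot0r cmod0 rnorm0 mulr0.
have yp := rnorm_gt0 y0.
set m := cmod (dotp x y) in cx *.
have y2 : 0 < rnorm y ^+ 2 by rewrite exprn_gt0.
(* The real [t] that minimises the norm of [c *: x + t *: y]. *)
pose t := - (m / rnorm y ^+ 2).
have := sqr_ge0 (rnorm (c *: x + t%:C *: y)).
rewrite rnorm_sqrD dotZr dotZl cx conjc_real -rmorphM /= !rnormZ c1 mul1r cmod_real.
rewrite exprMn real_normK ?num_real // => h.
have m0 : 0 <= m := cmod_ge0 _.
rewrite -(@ler_pXn2r _ 2) ?nnegrE ?mulr_ge0 ?rnorm_ge0 // exprMn.
rewrite -ler_pdivrMr //.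
have -> : m ^+ 2 / rnorm y ^+ 2 = m * (m / rnorm y ^+ 2) by rewrite expr2 mulrA.
move: h; rewrite /t sqrrN expr2 -mulrA divfK ?gt_eqF //; lra.
Qed.

Lemma parallelogram x y :
  rnorm (x + y) ^+ 2 + rnorm (x - y) ^+ 2 = 2 * rnorm x ^+ 2 + 2 * rnorm y ^+ 2.
Proof.
rewrite !rnorm_sqrD rnormN dotNr; case: (dotp x y) => a b /=; ring.
Qed.

(* [z] minimises [F x = |x| ^+ 2 - 2 Re (phi x)]. *)
Lemma riesz (phi : H -> R[i]) (C : R) :
  scalar phi -> (forall x, cmod (phi x) <= C * rnorm x) ->
  exists z, forall x, phi x = dotp x z.
Proof.
move=> phl phC.
have phD x y : phi (x + y) = phi x + phi y := linD (W := R[i]^o) phl x y.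
have phZ (c : R[i]) x : phi (c *: x) = c * phi x := linZ (W := R[i]^o) phl c x.
have phB x y : phi (x - y) = phi x - phi y := linB (W := R[i]^o) phl x y.
pose F x := rnorm x ^+ 2 - 2 * complex.Re (phi x).
have Flb x : - C ^+ 2 <= F x.
  have := phC x; have := Re_le_cmod (phi x); rewrite /F.
  have := sqr_ge0 (rnorm x - C); rewrite sqrrB mulr2n; lra.
pose S := range F.
have hS : has_inf S.
  by split; [exists (F 0), 0|exists (- C ^+ 2) => _ [x _ <-]].
pose d := inf S.
have dF x : d <= F x by apply: ge_inf; [case: hS|exists x].
have /choice[u hu] : forall n : nat, exists x, F x < d + n.+1%:R^-1.
  move=> n; have n0 : 0 < n.+1%:R^-1 :> R by rewrite invr_gt0.
  by have [_ [x _ <-] h] := inf_adherent n0 hS; exists x.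
(* The linear part of [F] cancels in the parallelogram law. As [F] is at least [d] at the midpoint,
   minimising sequences are Cauchy. *)
have mid x y : rnorm (x - y) ^+ 2 = 2 * F x + 2 * F y - 4 * F ((2^-1)%:C *: (x + y)).
  have := parallelogram x y; rewrite /F rnormZ phZ phD cmod_real ger0_norm //.
  rewrite exprMn => h.
  have -> : complex.Re ((2^-1)%:C * (phi x + phi y)) = 2^-1 * (complex.Re (phi x) + complex.Re (phi y)).
    by case: (phi x) (phi y) => a b [a' b'] /=; rewrite mul0r subr0.
  rewrite exprVn; lra.
have inv_small (e : R) : 0 < e -> exists n0 : nat, forall n, (n0 <= n)%N -> n.+1%:R^-1 < e.
  move=> e0; exists (Num.truncn e^-1) => n hn.
  rewrite invf_plt ?posrE // (lt_le_trans (truncnS_gt _)) // ler_nat ltnS //.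
have [z uz] : exists z, rlim u z.
  apply: rcomplete => e e0.

  have e4 : 0 < e ^+ 2 / 4 by rewrite divr_gt0 // exprn_gt0.
  have [n0 h0] := inv_small _ e4; exists n0 => m n /h0 hm /h0 hn.
  rewrite -(@ltr_pXn2r _ 2) ?nnegrE ?rnorm_ge0 ?(ltW e0) // mid.
  have := dF ((2^-1)%:C *: (u m + u n)); have := hu m; have := hu n.
  move: hm hn; move: (F (u n)) (F (u m)) (F _) (n.+1%:R^-1) (m.+1%:R^-1) => *; lra.
(* A nonnegative quadratic without constant term has no linear term; this makes the first variation
   of [F] at [z] vanish. *)
have quad (N g : R) : 0 <= N -> (forall t, 0 <= t ^+ 2 * N + 2 * t * g) -> g = 0.
  move=> N0 h; pose k := (N + 1)^-1.
  have k0 : 0 < k by rewrite invr_gt0 ltr_wpDl.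
  have kN : k * N = 1 - k.
    have : k * (N + 1) = 1 by rewrite mulVf // gt_eqF // ltr_wpDl.
    lra.
  apply/eqP/negPn/negP => g0.
  have := h (- (g * k)).
  have -> : (- (g * k)) ^+ 2 * N = g ^+ 2 * k * (k * N) by ring.
  rewrite kN.
  have gk : 0 < g ^+ 2 * k by rewrite mulr_gt0 // lt_def sqrf_eq0 g0 sqr_ge0.
  have : 0 < g ^+ 2 * k * k by rewrite mulr_gt0.
  move: gk; lra.
have eqRe h : complex.Re (dotp z h) = complex.Re (phi h).
  apply/eqP; rewrite -subr_eq0; apply/eqP; apply: (quad (rnorm h ^+ 2)); first exact: sqr_ge0.
  move=> t; apply/ler_addgt0Pl => e e0.
  have C0 : 0 < 4 * (`|t| * rnorm h + 1).
    by rewrite mulr_gt0 // ltr_wpDl // mulr_ge0 ?rnorm_ge0.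
  have e2 : 0 < e / 2 by rewrite divr_gt0.
  have [n1 h1] := inv_small _ e2; have [n2 h2] := uz _ (divr_gt0 e0 C0).
  pose n := maxn n1 n2.
  have := hu n; have := h1 n (leq_maxl _ _); have := dF (u n + t%:C *: h).
  have := h2 n (leq_maxr _ _); rewrite ltr_pdivlMr // => d4.
  have : `|t * complex.Re (dotp (u n - z) h)| <= `|t| * (rnorm h * rnorm (u n - z)).
    rewrite normrM ler_wpM2l // -lecR (le_trans (normc_ge_Re _)) // cmodE lecR mulrC.
    exact: cauchy_schwarz.
  rewrite ler_norml => /andP[lb ub].
  rewrite /F rnorm_sqrD phD phZ dotZr conjc_real rnormZ cmod_real exprMn real_normK ?num_real //.
  move: lb ub; rewrite dotBl.
  have := rnorm_ge0 (u n - z).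
  case: (dotp (u n) h) => a1 b1; case: (dotp z h) => a2 b2; case: (phi h) => a3 b3.
  case: (phi (u n)) => a4 b4 /=.
  rewrite !mul0r !subr0; move: (n.+1%:R^-1) => i r0 lb ub; lra.
exists z => x; apply/eqP; rewrite eq_complex; apply/andP; split; apply/eqP.
  by rewrite dotC -eqRe; case: (dotp z x).
have := eqRe ('i%C *: x); rewrite phZ dotZr dotC.
by case: (phi x) (dotp x z) => a b [a' b'] /=; lra.
Qed.

Lemma bop_bound T : bounded_op T ->
  exists2 C : R, 0 < C & forall x, rnorm (T x) <= C * rnorm x.
Proof. by case=> Tl Tc; exact: linear_bounded. Qed.

Lemma bopI T (C : R) : linear T -> (forall x, rnorm (T x) <= C * rnorm x) -> bounded_op T.
Proof. by move=> Tl TC; split=> //; exact: bounded_linear TC. Qed.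

Lemma bop_comp S T : bounded_op S -> bounded_op T -> bounded_op (S \o T).
Proof.
move=> Sb Tb; have [C1 C10 h1] := bop_bound Sb; have [C2 C20 h2] := bop_bound Tb.
apply: (@bopI _ (C1 * C2)) => [c x y|x] /=; first by rewrite Tb.1 Sb.1.
by rewrite (le_trans (h1 _)) // -mulrA ler_wpM2l // ltW.
Qed.

Lemma bop_sub S T : bounded_op S -> bounded_op T -> bounded_op (fun x => S x - T x).
Proof.
move=> Sb Tb; have [C1 C10 h1] := bop_bound Sb; have [C2 C20 h2] := bop_bound Tb.
apply: (@bopI _ (C1 + C2)) => [c x y|x] /=.
  by rewrite Tb.1 Sb.1 opprD addrACA scalerBr.
by rewrite (le_trans (rnormB _ _)) // mulrDl lerD.
Qed.

Lemma bop_scale c T : bounded_op T -> bounded_op (fun x => c *: T x).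
Proof.
move=> Tb; have [C1 C10 h1] := bop_bound Tb.
apply: (@bopI _ (cmod c * C1)) => [a x y|x] /=.
  by rewrite Tb.1 scalerDr !scalerA mulrC.
by rewrite rnormZ -mulrA ler_wpM2l ?cmod_ge0.
Qed.

Lemma bop_id : bounded_op (id : H -> H).
Proof. by apply: (@bopI _ 1) => [//|x]; rewrite mul1r. Qed.

(** [adj] is a choice by [get]; nondegeneracy of the inner product identifies the choice with any
    witness. *)
Lemma adj_eq S T : (forall x y, dotp (T x) y = dotp x (S y)) -> adj T = S.
Proof.
move=> h; have /= h2 : [set S' | forall x y, dotp (T x) y = dotp x (S' y)] (adj T).
  by apply: getPex; exists S.
by apply/funext => y; apply: dot_inj => x; rewrite -h2 h.
Qed.

Lemma adjP T : bounded_op T -> forall x y, dotp (T x) y = dotp x (adj T y).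
Proof.
move=> Tb; have [C C0 TC] := bop_bound Tb.
suff [S hS] : exists S, forall x y, dotp (T x) y = dotp x (S y) by rewrite (adj_eq hS).
suff /choice[S hS] : forall y, exists z, forall x, dotp (T x) y = dotp x z.
  by exists S => x y; rewrite hS.
move=> y; apply: (@riesz (fun x => dotp (T x) y) (C * rnorm y)) => [c x z|x].
  by rewrite Tb.1 dotDl dotZl.
rewrite (le_trans (cauchy_schwarz _ _)) // mulrAC ler_wpM2r ?rnorm_ge0 //.
Qed.

Lemma adjP2 T : bounded_op T -> forall x y, dotp (adj T x) y = dotp x (T y).
Proof. by move=> Tb x y; rewrite dotC -adjP // -dotC. Qed.

Lemma bop_adj_bound T (C : R) : bounded_op T -> (forall x, rnorm (T x) <= C * rnorm x) ->
  forall x, rnorm (adj T x) <= C * rnorm x.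
Proof.
move=> Tb TC x; have [->|y0] := eqVneq (adj T x) 0.
  by rewrite rnorm0 (le_trans (rnorm_ge0 (T x))).
rewrite -(ler_pM2r (rnorm_gt0 y0)) -expr2.
have : cmod (dotp (adj T x) (adj T x)) = rnorm (adj T x) ^+ 2.
  by rewrite dotxx cmod_real ger0_norm // sqr_ge0.
move=> <-; rewrite adjP2 // (le_trans (cauchy_schwarz _ _)) //.
by rewrite mulrC mulrAC ler_wpM2r ?rnorm_ge0.
Qed.

Lemma bop_adj T : bounded_op T -> bounded_op (adj T).
Proof.
move=> Tb; have [C C0 TC] := bop_bound Tb.
apply: (@bopI _ C); last exact: bop_adj_bound.
move=> c x y; apply: dot_inj => z.
by rewrite -adjP // !dotDr !dotZr !adjP.
Qed.

Lemma adjK T : bounded_op T -> adj (adj T) = T.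
Proof. by move=> Tb; apply: adj_eq => x y; rewrite adjP2. Qed.

Lemma adj_comp S T : bounded_op S -> bounded_op T -> adj (S \o T) = adj T \o adj S.
Proof. by move=> Sb Tb; apply: adj_eq => x y /=; rewrite !adjP. Qed.

Lemma adj_scale c T : bounded_op T -> adj (fun x => c *: T x) = fun x => c^*%C *: adj T x.
Proof. by move=> Tb; apply: adj_eq => x y; rewrite dotZl dotZr conjcK adjP. Qed.

Lemma rnorm_projection p : projection p -> forall x, rnorm (p x) <= rnorm x.
Proof.
move=> [pb pp pa] x; have [->|y0] := eqVneq (p x) 0; first by rewrite rnorm0 rnorm_ge0.
rewrite -(ler_pM2r (rnorm_gt0 y0)) -expr2.
have <- : cmod (dotp (p x) (p x)) = rnorm (p x) ^+ 2.
  by rewrite dotxx cmod_real ger0_norm // sqr_ge0.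
rewrite adjP // pa -[p (p x)]/((p \o p) x) pp; exact: cauchy_schwarz.
Qed.

Lemma projection_dot p x : projection p -> dotp (p x) x = (rnorm (p x) ^+ 2)%:C.
Proof.
by move=> [pb pp pa]; rewrite -dotxx [in RHS]adjP // pa -[p (p x)]/((p \o p) x) pp adjP // pa.
Qed.

Lemma rnorm_unitary u : unitary u -> forall x, rnorm (u x) = rnorm x.
Proof.
move=> [ub _ uu] x; apply/eqP; rewrite -(@eqrXn2 _ 2) ?rnorm_ge0 //; apply/eqP.
by apply: complexI; rewrite -!dotxx adjP // -[adj u (u x)]/((adj u \o u) x) uu.
Qed.

End HilbertSpace.

(** * Representations *)

Section Representation.
Context {R : realType} {A : cstarAlgType R} {H : hilbertType R} (pi : A -> H -> H).
Hypothesis pi_rep : star_representation pi.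
Implicit Types (a b c : A) (x y : H) (k : R[i]) (p q S T : H -> H).

Lemma pi_bop a : bounded_op (pi a). Proof. by case: pi_rep. Qed.
Lemma piP k a b x : pi (k *: a + b) x = k *: pi a x + pi b x.
Proof. by case: pi_rep. Qed.
Lemma piD a b x : pi (a + b) x = pi a x + pi b x.
Proof. by rewrite -{1}(scale1r a) piP scale1r. Qed.
Lemma pi0 x : pi 0 x = 0.
Proof. by apply: (addrI (pi 0 x)); rewrite -piD !addr0. Qed.
Lemma piZ k a x : pi (k *: a) x = k *: pi a x.
Proof. by rewrite -[k *: a]addr0 piP pi0 addr0. Qed.
Lemma piB a b x : pi (a - b) x = pi a x - pi b x.
Proof. by rewrite piD -scaleN1r piZ scaleN1r. Qed.
Lemma piN a x : pi (- a) x = - pi a x.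
Proof. by rewrite -scaleN1r piZ scaleN1r. Qed.
Lemma piM a b x : pi (cmul a b) x = pi a (pi b x).
Proof. by case: pi_rep => _ _ -> _. Qed.
Lemma pi_star a : pi (cstar a) = adj (pi a).
Proof. by case: pi_rep. Qed.
Lemma pi_dot a x y : dotp (pi a x) y = dotp x (pi (cstar a) y).
Proof. by rewrite pi_star adjP //; exact: pi_bop. Qed.
Lemma pi_dot2 a x y : dotp (pi (cstar a) x) y = dotp x (pi a y).
Proof. by rewrite pi_dot cstarK. Qed.

Lemma pi_star_mul a x : dotp (pi (cmul (cstar a) a) x) x = (rnorm (pi a x) ^+ 2)%:C.
Proof. by rewrite piM pi_dot2 dotxx. Qed.

(* If [|a| < 1] then [1 - a* a = u ^+ 2] with [u] self-adjoint, so
   [|x| ^+ 2 - |pi a x| ^+ 2 = |u x| ^+ 2]. *)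
Lemma pi_contractive a x : rnorm (pi a x) <= rnorm a * rnorm x.
Proof.
have small b : rnorm b < 1 -> rnorm (pi b x) <= rnorm x.
  move=> b1; pose h : unitization A := unit_emb (cmul (cstar b) b).
  have [||w [ws _ wE]] := @sqrt_one_sub _ _ _ _ (@unit_cstar_norm R A) h.
  - apply: injective_projections; first exact: conjc0.
    by rewrite /= cstarM cstarK.
  - by rewrite unit_norm_emb rnorm_star_mul expr_lt1 // rnorm_ge0.
  have us : unit_star (1 - w) = 1 - w.
    by rewrite (starB unit_cstar_norm) ws (star1 unit_cstar_norm).
  move: (1 - w) us wE => [k c] [ks cs] [k2 uc].
  have k2' : k * k = 1 :> R[i] by rewrite [LHS]k2 subr0.
  have uc' : k *: c + k *: c + cmul c c = - cmul (cstar b) b by rewrite uc sub0r.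
  rewrite -(@ler_pXn2r _ 2) ?nnegrE ?rnorm_ge0 // -subr_ge0 -lecR rmorphB /=.
  suff -> : (rnorm x ^+ 2)%:C - (rnorm (pi b x) ^+ 2)%:C = (rnorm (k *: x + pi c x) ^+ 2)%:C.
    by rewrite lecR sqr_ge0.
  have E1 : dotp x (pi c x) = dotp (pi c x) x by rewrite -pi_dot2 cs.
  have E2 : dotp (pi (cmul c c) x) x = dotp (pi c x) (pi c x) by rewrite piM -{1}cs pi_dot2.
  have -> : (rnorm (pi b x) ^+ 2)%:C = - (k * dotp (pi c x) x + k * dotp (pi c x) x + dotp (pi c x) (pi c x)).
    rewrite -pi_star_mul -[cmul _ b]opprK -uc' -scaleN1r piZ scaleN1r dotNl.
    by rewrite !piD !piZ !dotDl !dotZl E2.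
  rewrite -!dotxx dotDr !dotDl !dotZl !dotZr [k^*%C]ks E1 mulrA k2' mul1r opprK.
  by rewrite !addrA [_ + k * _ + _]addrAC.
have [->|a0] := eqVneq a 0; first by rewrite pi0 !rnorm0 mul0r.
have na := rnorm_gt0 a0.
apply/ler_addgt0Pr => e e0.
pose r := rnorm a + e / (rnorm x + 1).
have x1 : 0 < rnorm x + 1 by rewrite ltr_wpDl ?rnorm_ge0.
have r0 : 0 < r by rewrite addr_gt0 // divr_gt0.
have ri : 0 < r^-1 by rewrite invr_gt0.
have := small (r^-1%:C *: a); rewrite piZ !rnormZ cmod_real gtr0_norm //.
rewrite ![r^-1 * _]mulrC ltr_pdivrMr // ler_pdivrMr // mul1r ltrDl divr_gt0 //.
move=> /(_ isT) /le_trans; apply; rewrite mulrC mulrDl lerD2l.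
by rewrite mulrAC ler_pdivrMr // ler_pM2l //; lra.
Qed.

(** [pi a] lies in the bicommutant, so it serves itself as the middle factor. *)
Lemma her_iff p a : projection p -> 
  her pi p a <-> (forall x, p (pi a x) = pi a x) /\ (forall x, pi a (p x) = pi a x).
Proof.
move=> [pb pp pa]; have ppx x : p (p x) = p x by rewrite -[p (p x)]/((p \o p) x) pp.
split=> [[T _ E]|[h1 h2]].
  by split=> x; rewrite E /= ?ppx.
exists (pi a); last by apply/funext => x /=; rewrite h2 h1.
split; first exact: pi_bop.
move=> S [Sb hS]; apply/funext => x /=.
have := hS (pi a) (ex_intro2 _ _ a I erefl).
by move=> /(congr1 (fun f => f x)) /= ->.
Qed.

Lemma projection_compl p : projection p -> projection (fun x => x - p x).
Proof.
move=> [pb pp pa]; split.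
- by apply: bop_sub => //; exact: bop_id.
- apply/funext => x /=; rewrite (linB pb.1) -[p (p x)]/((p \o p) x) pp subrr.
  by rewrite subr0.
- by apply: adj_eq => x y; rewrite dotBl dotBr adjP // pa.
Qed.

Hypothesis pi_univ : exists xi : (A -> R[i]) -> H,
  forall f, state f -> forall a, f a = dotp (pi a (xi f)) (xi f).

(* With [k = a* a] and [eta = pi k xi] for a state norming [k ^+ 2],
   [|eta| <= |k|] while [|pi k eta| = |k| ^+ 2]. *)
Lemma pi_bounded_below a (C : R) : 0 <= C -> (forall x, rnorm (pi a x) <= C * rnorm x) ->
  rnorm a <= C.
Proof.
move=> C0 aC; have [->|a0] := eqVneq a 0; first by rewrite rnorm0.
have na := rnorm_gt0 a0.
pose k := cmul (cstar a) a; have ks : cstar k = k by rewrite cstarM cstarK.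
have nk : rnorm k = rnorm a ^+ 2 by rewrite rnorm_star_mul.
pose k2 := cmul k k; have k2s : cstar k2 = k2 by rewrite cstarM ks.
have nk2 : rnorm k2 = rnorm k ^+ 2 by rewrite -rnorm_star_mul ks.
have nk0 : 0 < rnorm k by rewrite nk exprn_gt0.
have k20 : k2 != 0.
  apply/eqP => k20; have : 0 < rnorm k ^+ 2 by rewrite exprn_gt0.
  by rewrite -nk2 k20 rnorm0 ltxx.
have [f [fst fN fk]] := state_norming k2s k20.
have [xi /(_ f fst) xiE] := pi_univ.
pose eta := pi k (xi f).
have n1 : rnorm eta <= rnorm k.
  rewrite -(@ler_pXn2r _ 2) ?nnegrE ?rnorm_ge0 // -nk2.
  have k2E : k2 = cmul (cstar k) k by rewrite ks.
  by have := fN k2; rewrite xiE [in X in X <= _]k2E pi_star_mul cmod_real ger0_norm ?sqr_ge0.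
have n2 : rnorm (pi k eta) = rnorm k ^+ 2.
  rewrite -nk2; apply/eqP; rewrite -(@eqrXn2 _ 2) ?rnorm_ge0 //; apply/eqP; apply: complexI; rewrite -fk.
  have -> : cmul k2 k2 = cmul (cstar k2) k2 by rewrite k2s.
  by rewrite xiE pi_star_mul /eta -piM.
have n3 : rnorm (pi k eta) <= C * (C * rnorm k).
  rewrite /k piM pi_star (le_trans (bop_adj_bound (pi_bop a) aC _)) // ler_wpM2l //.
  by rewrite (le_trans (aC _)) // ler_wpM2l.
move: n3; rewrite n2 mulrA expr2 ler_pM2r // nk -expr2.
by rewrite ler_pXn2r ?nnegrE ?rnorm_ge0.
Qed.

(** Since [pi] is isometric, norm convergence of the images makes [c] Cauchy in [A]. *)
Lemma range_pi_closed T (c : nat -> A) :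
  (forall e : R, 0 < e -> exists n0, forall n, (n0 <= n)%N ->
     forall x, rnorm (pi (c n) x - T x) <= e * rnorm x) ->
  exists b, forall x, pi b x = T x.
Proof.
move=> cT.
have [|b cb] := @rcomplete R A c.
  move=> e e0; have e4 : 0 < e / 4 by rewrite divr_gt0.
  have [n0 h] := cT _ e4; exists n0 => m n hm hn.
  apply: le_lt_trans (_ : e / 2 < e); last by lra.
  apply: pi_bounded_below => [|x]; first by lra.
  rewrite piB (le_trans (rnorm_tri (T x) _ _)) // [rnorm (T x - _)]rnormC.
  have := h m hm x; have := h n hn x; have := rnorm_ge0 x; nra.
exists b => x; apply/eqP; rewrite -subr_eq0; apply/eqP; apply: rnorm_small0 => e e0.
have x1 : 0 < 2 * (rnorm x + 1) by rewrite mulr_gt0 // ltr_wpDl ?rnorm_ge0.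
have [n1 h1] := cT _ (divr_gt0 e0 x1); have [n2 h2] := cb _ (divr_gt0 e0 x1).
pose n := maxn n1 n2.
have := h1 n (leq_maxl _ _) x; have := h2 n (leq_maxr _ _).
have := pi_contractive (b - c n) x; rewrite piB [rnorm (b - _)]rnormC.
have := rnorm_tri (pi (c n) x) (pi b x) (T x).
set d := e / (2 * (rnorm x + 1)) => H1 H2 H3 H4.
have dE : d * (2 * (rnorm x + 1)) = e by rewrite /d divfK // gt_eqF.
have d0 : 0 < d by rewrite divr_gt0.
have : rnorm (c n - b) * rnorm x <= d * rnorm x by rewrite ler_wpM2r ?rnorm_ge0 // ltW.
lra.
Qed.

End Representation.

(** * Upper limits of real functionals *)

Section LimSup.
Context {R : realType} {V : lmodType R[i]} (q : nat -> V -> R) (K : V -> R).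
Hypothesis qD : forall n x y, q n (x + y) = q n x + q n y.
Hypothesis qZ : forall n (r : R) x, q n (r%:C *: x) = r * q n x.
Hypothesis qK : forall n x, `|q n x| <= K x.

Let tail x : set R := [set C | exists N, forall n, (N <= n)%N -> q n x <= C].
(** The upper limit as the infimum of the eventual upper bounds. A linear functional below it
    inherits every upper bound that the [q n] satisfy eventually. *)
Definition limsup_fun x : R := inf (tail x).

Let tail_inf x : has_inf (tail x).
Proof.
split; first by exists (K x), 0%N => n _; have := qK n x; rewrite ler_norml => /andP[].
exists (- K x) => C [N /(_ N (leqnn N))]; apply: le_trans.
by have := qK N x; rewrite ler_norml => /andP[].
Qed.

Lemma limsup_fun_le x C N : (forall n, (N <= n)%N -> q n x <= C) -> limsup_fun x <= C.
Proof. by move=> h; apply: ge_inf; [case: (tail_inf x)|exists N]. Qed.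

Lemma limsup_fun_ge x C : (forall n, C <= q n x) -> C <= limsup_fun x.
Proof.
move=> h; apply: lb_le_inf; first by case: (tail_inf x).
by move=> D [N /(_ N (leqnn N))]; apply: le_trans.
Qed.

Lemma limsup_fun_sublinear :
  (forall x y, limsup_fun (x + y) <= limsup_fun x + limsup_fun y) /\
  (forall (r : R) x, 0 <= r -> limsup_fun (r%:C *: x) = r * limsup_fun x).
Proof.
split=> [x y|].
  apply/ler_addgt0Pr => e e0; have e2 : 0 < e / 2 by rewrite divr_gt0.
  have [C1 [N1 h1] c1] := inf_adherent e2 (tail_inf x).
  have [C2 [N2 h2] c2] := inf_adherent e2 (tail_inf y).
  apply: le_trans (_ : C1 + C2 <= _).
    apply: (@limsup_fun_le _ _ (maxn N1 N2)) => n; rewrite geq_max => /andP[n1 n2].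
    by rewrite qD lerD ?h1 ?h2.
  rewrite -/(limsup_fun x) in c1; rewrite -/(limsup_fun y) in c2; lra.
have le (r : R) x : 0 < r -> limsup_fun (r%:C *: x) <= r * limsup_fun x.
  move=> r0; rewrite -ler_pdivrMl //; apply: lb_le_inf; first by case: (tail_inf x).
  move=> C [N h]; rewrite ler_pdivrMl //; apply: (@limsup_fun_le _ _ N) => n /h.
  by rewrite qZ ler_pM2l.
move=> r x; rewrite le_eqVlt => /predU1P[<-|r0].
  have q0 n : q n (0%:C *: x) = 0 by rewrite qZ mul0r.
  rewrite mul0r; apply/eqP; rewrite eq_le limsup_fun_ge ?andbT; last by move=> n; rewrite q0.
  by apply: (@limsup_fun_le _ _ 0%N) => n _; rewrite q0.
apply/eqP; rewrite eq_le le //=.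
have ri : 0 < r^-1 by rewrite invr_gt0.
have := le r^-1 (r%:C *: x) ri; rewrite scalerA -rmorphM mulVf ?gt_eqF // scale1r.
by rewrite ler_pdivlMl.
Qed.

End LimSup.

(** * Precompact supports *)

Section Spectral.
Context {R : realType} (mu : {finite_measure set R -> \bar R}).
Local Notation I M := (`[0, M]%classic : set R).

Lemma integral_itv_fin (M : R) : 0 <= M ->
  (0 <= \int[mu]_(t in I M) t%:E /\ \int[mu]_(t in I M) t%:E <= M%:E * mu (I M))%E.
Proof.
move=> M0; have mI : measurable (I M) by exact: measurable_itv.
split.
  by apply: integral_ge0 => t /=; rewrite in_itv /= lee_fin => /andP[].
rewrite -integral_cst //; apply: ge0_le_integral => //.
- by move=> t /=; rewrite in_itv /= lee_fin => /andP[].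
- by move=> t /=; rewrite in_itv /= lee_fin => /andP[].
Qed.

Lemma integral_itv_le (M s : R) : 0 <= s <= M -> mu (`]s, M]%classic : set R) = 0%E ->
  \int[mu]_(t in I M) t <= s * fine (mu (I M)).
Proof.
move=> /andP[s0 sM] mu0.
have mI : measurable (I M) by exact: measurable_itv.
have M0 : 0 <= M by exact: le_trans sM.
have [i0 i1] := integral_itv_fin M0.
have mf : mu (I M) \is a fin_num by exact: fin_num_measure.
have fi : (\int[mu]_(t in I M) t%:E)%E \is a fin_num.
  by rewrite ge0_fin_numE // (le_lt_trans i1) // -[mu _]fineK // -EFinM ltry.
rewrite /Rintegral -lee_fin EFinM !fineK //.
rewrite -integral_cst //; apply: ae_ge0_le_integral => //.
- by move=> t /=; rewrite in_itv /= lee_fin => /andP[].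
exists (`]s, M]%classic : set R); split => //.
move=> t /= /not_implyP[]; rewrite !in_itv /= => /andP[t0 tM].
by rewrite lee_fin => /negP; rewrite -ltNge => ->.
Qed.

(** Markov's inequality. *)
Lemma integral_itv_eq0 (M s : R) : 0 < s -> 0 <= M -> \int[mu]_(t in I M) t = 0 ->
  mu (`]s, M]%classic : set R) = 0%E.
Proof.
move=> s0 M0 int0.
have mI : measurable (I M) by exact: measurable_itv.
have mJ : measurable (`]s, M]%classic : set R) by exact: measurable_itv.
have [i0 i1] := integral_itv_fin M0.
have mf : mu (I M) \is a fin_num by exact: fin_num_measure.
have e0 : (\int[mu]_(t in I M) t%:E = 0)%E.
  move: int0; rewrite /Rintegral => h; rewrite -[LHS]fineK ?h //.
  rewrite ge0_fin_numE // (le_lt_trans i1) // -[mu _]fineK // -EFinM ltry //.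
have : (s%:E * mu `]s, M]%classic <= 0)%E.
  rewrite -e0 -integral_cst //.
  apply: (@le_trans _ _ (\int[mu]_(t in `]s, M]%classic) t%:E)%E).
    apply: ge0_le_integral => //.
    - by move=> t _; rewrite lee_fin ltW.
    - move=> t /=; rewrite in_itv /= lee_fin => /andP[/ltW st _]; exact: le_trans st; exact: ltW.
  apply: ge0_subset_integral => //.
  - by move=> t /=; rewrite in_itv /= lee_fin => /andP[].
  - by move=> t /=; rewrite !in_itv /= => /andP[st ->]; rewrite andbT (le_trans (ltW s0)) // ltW.
rewrite pmule_rle0 ?lte_fin // => h; apply/eqP; rewrite eq_le h /=.
exact: measure_ge0.
Qed.

End Spectral.

Section PrecompactSupport.
Context {R : realType} {A : cstarAlgType R} {H : hilbertType R} (pi : A -> H -> H).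
Hypothesis pi_rep : star_representation pi.
Implicit Types (a b c : A) (x y : H) (k : R[i]) (p q S T : H -> H).

(** As [dotp (E B y) y] is the square of [rnorm (E B y)], the interval []s, rnorm a]] is null for
    the measure of [y] exactly when its projection kills [y]. Both claims then concern the integral
    of [t]. *)
Lemma spectral_dot a E (s : R) : spectral_measure pi a E -> 0 <= s <= rnorm a ->
  (forall y, E `]s, rnorm a]%classic y = 0 ->
     0 <= complex.Re (dotp (pi a y) y) <= s * rnorm y ^+ 2) /\
  (forall y, 0 < s -> dotp (pi a y) y = 0 -> E `]s, rnorm a]%classic y = 0).
Proof.
move=> [Eproj _ _ EI Emu] /andP[s0 sM].
have M0 : 0 <= rnorm a := rnorm_ge0 a.
have mI : measurable (`[0, rnorm a]%classic : set R) by exact: measurable_itv.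
have mJ : measurable (`]s, rnorm a]%classic : set R) by exact: measurable_itv.
have zero (mu : {finite_measure set R -> \bar R}) y :
    (forall B, measurable B -> dotp (E B y) y = (fine (mu B))%:C) ->
    mu (`]s, rnorm a]%classic : set R) = 0%E <-> E `]s, rnorm a]%classic y = 0.
  move=> muE; have := muE _ mJ; split=> [m0|e0].
    have := muE _ mJ; rewrite m0 /= projection_dot; last by case: (Eproj _ mJ).
    by move=> /complexI/eqP; rewrite sqrf_eq0 => /eqP/rnorm_eq0.
  have mf : mu (`]s, rnorm a]%classic : set R) \is a fin_num by exact: fin_num_measure.
  have := muE _ mJ; rewrite e0 dot0l => /esym/(@complexI R) h.
  by rewrite -(fineK mf) h.
split=> [y Ey|y sp ay]; have [mu [muE muI]] := Emu y; last first.
  apply/(zero mu) => //; apply: (integral_itv_eq0 sp M0).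
  by have := muI; rewrite ay => /esym/(@complexI R).
have [i0 _] := integral_itv_fin mu M0.
rewrite muI /=; apply/andP; split; first by rewrite /Rintegral fine_ge0.
have sM' : 0 <= s <= rnorm a by rewrite s0.
have mu0 := (zero mu y muE).2 Ey.
have := integral_itv_le sM' mu0.
have := muE _ mI; rewrite EI /= dotxx => /(@complexI R) <-.
by [].
Qed.

Section Fixed.
Variables (p : H -> H) (pK : nat -> H -> H).
Hypothesis pKsupp : precompact_support pi p pK.

Lemma support_projection : projection p.
Proof. by case: pKsupp => -[[]]. Qed.

Lemma pK_projection n : projection (pK n).
Proof.
case: pKsupp => _ _ [a [s [E [_ _ _ [Eproj _ _ _ _] ->]]]].
by have [] := Eproj _ (measurable_itv `]s n, rnorm a]).
Qed.

Lemma pK_mono m n x : (m <= n)%N -> pK m (pK n x) = pK m x /\ pK n (pK m x) = pK m x.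
Proof.
move=> mn; case: pKsupp => _ _ [a [s [E [_ _ [sdec _] [_ EI _ _ _] pKE]]]].
have sub : (`]s m, rnorm a] `&` `]s n, rnorm a] = `]s m, rnorm a])%classic.
  apply/setIidPl => t /=; rewrite !in_itv /= => /andP[mt ->]; rewrite andbT.
  exact: le_lt_trans (sdec _ _ mn) mt.
have mJ j : measurable (`]s j, rnorm a]%classic : set R) by exact: measurable_itv.
rewrite !pKE; split.
  by have /(congr1 (fun f => f x)) := EI _ _ (mJ m) (mJ n); rewrite sub.
by have /(congr1 (fun f => f x)) := EI _ _ (mJ n) (mJ m); rewrite setIC sub.
Qed.

(** A vector killed by [p] is killed by [pi a], so its spectral measure has no mass above [s n]. *)
Lemma pK_absorb n x : pK n (p x) = pK n x.
Proof.
have pP := support_projection; have [[pl _] _ _] := pP.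
case: (pK_projection n) => [[Kl _] _ _].
apply/eqP; rewrite -subr_eq0 -(linB Kl); apply/eqP.
have p0 : p (p x - x) = 0.
  by rewrite (linB pl) -[p (p x)]/((p \o p) x); case: pP => _ -> _; rewrite subrr.
move: (p x - x) p0 => y p0.
case: pKsupp => _ _ [a [s [E [[aher _ _] s0 _ Esp pKE]]]].
have /andP[sn sM] := s0 n.
have sM' : 0 <= s n <= rnorm a by rewrite ltW.
have [_ h] := spectral_dot Esp sM'.
rewrite pKE; apply: h => //.
have [_ ap] := (her_iff pi_rep a pP).1 aher.
by rewrite -ap p0 (lin0 (pi_bop pi_rep a).1) dot0l.
Qed.

Lemma her_star_mul b : her pi p b -> her pi p (cmul (cstar b) b).
Proof.
have pP := support_projection; have [pb _ pa] := pP.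
move=> /(her_iff pi_rep b pP)[h1 h2]; apply/(her_iff pi_rep _ pP); split=> x.
  rewrite !(piM pi_rep) (pi_star pi_rep); apply: dot_inj => y.
  rewrite -[p in p (adj _ _)]pa -adjP // -!(adjP (pi_bop pi_rep b)).
  by rewrite h2.
by rewrite !(piM pi_rep) h2.
Qed.

(* If [pi b (1 - pK n)] did not tend to [0] in norm, a limit of vector states at
   vectors in the ranges of the [1 - pK n] would vanish at the strictly positive
   element but not at [b* b]. *)
Lemma her_tail b (e : R) : her pi p b -> 0 < e ->
  exists n, forall x, rnorm (pi b (x - pK n x)) <= e * rnorm x.
Proof.
move=> bher e0; apply: contrapT => /forallNP neg.
have {neg} /choice[x0 hx0] : forall n, exists x, e * rnorm x < rnorm (pi b (x - pK n x)).
  by move=> n; have /existsNP[x /negP] := neg n; rewrite -ltNge => h; exists x.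
case: pKsupp => _ _ [a [s [E [[aher _ apos] s0 [_ slim] Esp pKE]]]].
have x0n n : 0 < rnorm (x0 n).
  apply: rnorm_gt0; apply/eqP => x00; have := hx0 n; rewrite x00.
  have [[Kl _] _ _] := pK_projection n.
  by rewrite (lin0 Kl) subr0 (lin0 (pi_bop pi_rep b).1) !rnorm0 mulr0 ltxx.
(* Vectors of norm at most one that [pK n] kills and on which [pi b] stays bounded below by [e]. *)
pose y n := (rnorm (x0 n))^-1%:C *: (x0 n - pK n (x0 n)).
have y1 n : rnorm (y n) <= 1.
  have := rnorm_projection (projection_compl (pK_projection n)) (x0 n).
  by rewrite rnormZ cmod_real ger0_norm ?invr_ge0 ?rnorm_ge0 // mulrC ler_pdivrMr // mul1r.
have Ky n : pK n (y n) = 0.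
  have [[Kl _] KK _] := pK_projection n.
  rewrite (linZ Kl) (linB Kl) -[pK n (pK n _)]/((pK n \o pK n) _) KK subrr scaler0 //.
have yb n : e <= rnorm (pi b (y n)).
  rewrite (linZ (pi_bop pi_rep b).1) rnormZ cmod_real ger0_norm ?invr_ge0 ?rnorm_ge0 //.
  by rewrite mulrC ler_pdivlMr // ltW.
pose q n (c : A) := complex.Re (dotp (pi c (y n)) (y n)).
have qD n c d : q n (c + d) = q n c + q n d.
  rewrite /q (piD pi_rep) dotDl.
  by case: (dotp _ _) (dotp (pi d _) _) => ? ? [].
have qZ n (r : R) c : q n (r%:C *: c) = r * q n c.
  rewrite /q (piZ pi_rep) dotZl.
  by case: (dotp _ _) => ? ? /=; rewrite mul0r subr0.
have qK n c : `|q n c| <= rnorm c.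
  rewrite -lecR (le_trans (normc_ge_Re _)) // cmodE lecR (le_trans (cauchy_schwarz _ _)) //.
  have := pi_contractive pi_rep c (y n) => h.
  apply: le_trans (_ : rnorm c * 1 * 1 <= _); last by rewrite !mulr1.
  rewrite ler_pM ?rnorm_ge0 // (le_trans h) // ler_wpM2l ?rnorm_ge0 //.
have [subD subZ] := limsup_fun_sublinear qD qZ qK.
(* The upper limit is attained at [b* b], where every [q n] is at least [e ^+ 2]; hence [phi] is
   nonzero on Her(p). *)
have [phi [phl phle ph0]] := complex_hahn_banach (cmul (cstar b) b) subD subZ.
have qs n c : dotp (pi (cmul (cstar c) c) (y n)) (y n) = (rnorm (pi c (y n)) ^+ 2)%:C.
  by rewrite (pi_star_mul pi_rep).
have phN c : phi (- c) = - phi c := linN (W := R[i]^o) phl c.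
have phZ (k : R[i]) c : phi (k *: c) = k * phi c := linZ (W := R[i]^o) phl k c.
(* Only real parts are dominated: the bound at [- d] gives the sign, and those at ['i d] and
   [- 'i d] remove the imaginary part. *)
have phpos c : 0 <= phi (cmul (cstar c) c).
  set d := cmul (cstar c) c.
  have h1 : complex.Re (phi (- d)) <= 0.
    apply: le_trans (phle _) _; apply: (@limsup_fun_le _ _ _ _ qK _ _ 0%N) => n _.
    by rewrite /q (piN pi_rep) dotNl qs /= oppr_le0 sqr_ge0.
  have him (k : R[i]) : complex.Re k = 0 -> complex.Re (phi (k *: d)) <= 0.
    move=> k0; apply: le_trans (phle _) _; apply: (@limsup_fun_le _ _ _ _ qK _ _ 0%N) => n _.
    by rewrite /q (piZ pi_rep) dotZl qs; case: k k0 => ? ? /= ->; rewrite mul0r mulr0 subr0.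
  have := him 'i%C erefl; have := him (- 'i%C) (oppr0 _); rewrite !phZ.
  move: h1; rewrite phN lecE; case: (phi d) => u v /=.
  move=> h1 h2 h3; apply/andP; split; last by lra.
  by apply/eqP; lra.
have ab0 : 0 < phi a.
  apply: apos => [k c d _ _|c _|]; first exact: phl.
    exact: phpos.
  exists (cmul (cstar b) b); first exact: her_star_mul.
  apply/eqP => z0; move: ph0; rewrite z0 /= => /esym h.
  have : e ^+ 2 <= 0.
    rewrite -h; apply: (@limsup_fun_ge _ _ _ _ qK) => n.
    by rewrite /q qs /= ler_pXn2r ?nnegrE ?rnorm_ge0 ?(ltW e0).
  by rewrite leNgt exprn_gt0.
(* The contradiction: [pK n] kills [y n], so [q n a <= s n], and the upper limit at [a] is at most
   0. *)
have : 0 < complex.Re (phi a) by move: ab0; rewrite ltcE => /andP[].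
apply/negP; rewrite -leNgt (le_trans (phle a)) //.
apply/ler_addgt0Pr => d d0; rewrite add0r.
move: slim => /cvgrPdist_lt/(_ d d0)[N _ hN].
apply: (@limsup_fun_le _ _ _ _ qK _ _ N) => n /hN /=.
have /andP[sn sM] := s0 n; rewrite sub0r normrN gtr0_norm // => sd.
have sM' : 0 <= s n <= rnorm a by rewrite ltW.
have [h _] := spectral_dot Esp sM'.
have := h (y n); rewrite -pKE => /(_ (Ky n))/andP[_ h2].
apply: le_trans h2 _; apply: le_trans (ltW sd); rewrite ler_piMr ?(ltW sn) //.
by rewrite expr_le1 ?rnorm_ge0.
Qed.

(** The ranges of the [1 - pK n] decrease, so an estimate at one index persists. *)
Lemma her_tail_all b (e : R) : her pi p b -> 0 < e ->
  exists n0, forall n, (n0 <= n)%N -> forall x, rnorm (pi b (x - pK n x)) <= e * rnorm x.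
Proof.
move=> bher e0; have [n0 h] := her_tail bher e0; exists n0 => n n0n x.
have := h (x - pK n x); have [[Kl _] _ _] := pK_projection n0.
rewrite (linB Kl) (pK_mono _ n0n).1 subrr subr0 => /le_trans; apply.
by rewrite ler_pM2l // (rnorm_projection (projection_compl (pK_projection n))).
Qed.

(** Here [a] is an element with range projection [p], so the vectors [pi a y] are dense in the range
    of [p]. On them [1 - pK n] tends to zero, by the adjoint of the tail estimate for [a]. *)
Lemma pK_strong x : rlim (fun n => pK n x) (p x).
Proof.
have pP := support_projection; have [pb pp pa] := pP.
move=> e e0; have e2 : 0 < e / 2 by rewrite divr_gt0.
case: pKsupp => -[_ [a [c ac] [_ rp]]] _ _.
have as_ : cstar a = a by rewrite ac cstarM cstarK.
have pa1 y : p (pi a y) = pi a y.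
  have : range p (pi a y) by rewrite rp; apply: subset_closure; exists y.
  by case=> z _ <-; rewrite -[p (p z)]/((p \o p) z) pp.
have aher : her pi p a.
  apply/(her_iff pi_rep _ pP); split=> // y; apply: dot_inj => z.
  by rewrite -(pi_dot2 pi_rep) as_ -{1}pa -adjP // pa1 -{1}as_ (pi_dot2 pi_rep).
have : closure (range (pi a)) (p x) by rewrite -rp; exists x.
move=> /closureP/(_ _ e2)[_ [y _ <-] xy].
have y1 : 0 < rnorm y + 1 by rewrite ltr_wpDl ?rnorm_ge0.
have [n0 h] := her_tail_all aher (divr_gt0 e2 y1); exists n0 => n n0n.
have KP := projection_compl (pK_projection n); have [[Kl Kc] _ Ka] := KP.
rewrite -pK_absorb rnormC.
have -> : p x - pK n (p x) = (p x - pi a y - pK n (p x - pi a y)) + (pi a y - pK n (pi a y)).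
  by have /= <- := linD Kl (p x - pi a y) (pi a y); rewrite subrK.
apply: le_lt_trans (rnormD _ _) _.
have := rnorm_projection KP (p x - pi a y).
suff : rnorm (pi a y - pK n (pi a y)) <= e / 2 by lra.
have Tb : bounded_op (pi a \o (fun z => z - pK n z)) by apply: bop_comp => //; exact: pi_bop.
have := bop_adj_bound Tb (h n n0n) y.
have -> : adj (pi a \o (fun z => z - pK n z)) y = pi a y - pK n (pi a y).
  by rewrite adj_comp ?Ka //= -?(pi_star pi_rep) ?as_ //; exact: pi_bop.
move=> /le_trans; apply; rewrite mulrAC ler_pdivrMr // ler_pM2l //; lra.
Qed.

(** Otherwise [p] would be [pi 0], against [p] not being in [A]. The nonzero projection serves to
    fix the phases. *)
Lemma pK_neq0 : exists n x, pK n x <> 0.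
Proof.
apply: contrapT => /forallNP h; case: pKsupp => _ + _; apply.
exists 0 => //; apply/funext => x; rewrite (pi0 pi_rep).
have K0 n : pK n x = 0 by apply: contrapT => h2; apply: (h n); exists x.
apply: (@rlim_uniq _ _ (fun n => pK n x)); last exact: pK_strong.
by move=> e e0; exists 0%N => n _; rewrite K0 subrr rnorm0.
Qed.

End Fixed.
End PrecompactSupport.

(** * Cuntz equivalence *)

Section CuntzEquivalence.
Context {R : realType} {A : cstarAlgType R} {H : hilbertType R} (pi : A -> H -> H).
Hypothesis pi_rep : star_representation pi.
Hypothesis pi_univ : exists xi : (A -> R[i]) -> H,
  forall f, state f -> forall a, f a = dotp (pi a (xi f)) (xi f).
Implicit Types (a b c : A) (x y : H) (k : R[i]) (p q S T : H -> H).

(** Polarization; it turns equality of the norms of [v x] and [p x] into [v* v = p]. *)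
Lemma isometric_dot S T : linear S -> linear T -> (forall x, rnorm (S x) = rnorm (T x)) ->
  forall x y, dotp (S x) (S y) = dotp (T x) (T y).
Proof.
move=> Sl Tl ST.
have re x y : complex.Re (dotp (S x) (S y)) = complex.Re (dotp (T x) (T y)).
  have := rnorm_sqrD (S x) (S y); have := rnorm_sqrD (T x) (T y).
  rewrite -(linD Sl) -(linD Tl) !ST; lra.
move=> x y; apply/eqP; rewrite eq_complex re eqxx /=; apply/eqP.
have := re x ('i%C *: y); rewrite (linZ Sl) (linZ Tl) !dotZr.
by case: (dotp (S x) (S y)) (dotp (T x) (T y)) => u1 u2 [v1 v2] /=; lra.
Qed.

Lemma rlim_bounded T (C : R) (u : nat -> H) x : linear T ->
  (forall y, rnorm (T y) <= C * rnorm y) -> rlim u x -> rlim (fun n => T (u n)) (T x).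
Proof.
move=> Tl TC ux e e0; have C1 : 0 < `|C| + 1 by rewrite ltr_wpDl.
have [n0 h] := ux _ (divr_gt0 e0 C1); exists n0 => n /h.
rewrite -(linB Tl) ltr_pdivlMr // => h1; apply: le_lt_trans (TC _) _.
apply: le_lt_trans h1; rewrite mulrC ler_wpM2l ?rnorm_ge0 //.
by have := ler_norm C; lra.
Qed.

Lemma her_star p b : projection p -> her pi p b -> her pi p (cstar b).
Proof.
move=> pP; have [pb _ pa] := pP.
move=> /(her_iff pi_rep b pP)[h1 h2]; apply/(her_iff pi_rep _ pP).
rewrite (pi_star pi_rep); have Bb := pi_bop pi_rep b.
split=> x; apply: dot_inj => y; first by rewrite -{1}pa -!adjP // h2.
by rewrite -!(adjP Bb) -{1}pa -adjP // h1.
Qed.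

Lemma her_conj_multiplier u b : multiplier pi u ->
  exists c, forall x, pi c x = u (pi b (adj u x)).
Proof.
move=> [[ub _] um]; have [[d _ dE] _] := um b; have [[e _ eE] _] := um (cstar d).
exists (cstar e) => x; rewrite (pi_star pi_rep) eE adj_comp //; last exact: pi_bop.
by rewrite (pi_star pi_rep) (adjK (pi_bop pi_rep d)) dE.
Qed.

(** [v] and [V n] coincide on the range of [pK n], and dually [pK n v* = pK n (V n)*]; [v v* = q]
    and the action on Her(p) are transferred through these identities. Agreement starts at [N0], the
    index at which the phases are anchored. *)
Lemma cuntz_of_unitaries p q (pK Q V : nat -> H -> H) (N0 : nat) :
  precompact_support pi p pK -> precompact_support pi q Q ->
  (forall n, multiplier pi (V n) /\ unitary (V n)) ->
  (forall m n x, (N0 <= n <= m)%N -> V m (pK n x) = V n (pK n x)) ->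
  (forall n x, (N0 <= n)%N -> Q n x = V n (pK n (adj (V n) x))) ->
  cuntz_equivalent pi p q.
Proof.
move=> pS qS Vmu VV QE.
have pP := support_projection pS; have qP := support_projection qS.
have [pb pp pa] := pP; have [qb qq qa] := qP; have [pl _] := pb.
have ppx x : p (p x) = p x by rewrite -[LHS]/((p \o p) x) pp.
have Vb n : bounded_op (V n) by case: (Vmu n) => _ [].
have Vl n : linear (V n) by case: (Vb n).
have VN n x : rnorm (V n x) = rnorm x by apply: rnorm_unitary; case: (Vmu n).
have KP n := pK_projection pS n.
have Kl n : linear (pK n) by case: (KP n) => -[].
have pKx n x : p (pK n x) = pK n x.
  case: (KP n) => Kb _ Ka; apply: dot_inj => y.
  by rewrite -{1}pa -adjP // -{1}Ka -adjP // (pK_absorb pi_rep pS) adjP // Ka.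
have [v vlim] : exists v, forall x, rlim (fun n => V n (p x)) (v x).
  suff /choice[v hv] : forall x, exists y, rlim (fun n => V n (p x)) y by exists v.
  move=> x; apply: rcomplete => e e0; have e4 : 0 < e / 4 by rewrite divr_gt0.
  have [n1 h1] := pK_strong pi_rep pS x e4.
  pose n := maxn N0 n1; exists n => i j hi hj.
  (* [V l] and [V n] agree on [pK n x], and both move the small vector [p x - pK n x]
     isometrically. *)
  have close l : (n <= l)%N -> rnorm (V l (p x) - V n (p x)) < e / 2.
    move=> nl; have := h1 n (leq_maxr _ _); rewrite rnormC => h.
    apply: le_lt_trans (rnorm_tri (V n (pK n x)) _ _) _.
    rewrite -{1}(VV l n) ?leq_maxl //= -(linB (Vl l)) VN.
    by rewrite -(linB (Vl n)) VN [X in _ + X]rnormC; lra.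
  have := rnorm_tri (V n (p x)) (V i (p x)) (V j (p x)).
  have := close i hi; have := close j hj; rewrite [rnorm (V n _ - _)]rnormC; lra.
have vl : linear v.
  move=> k x y; apply: (@rlim_uniq _ _ (fun n => V n (p (k *: x + y)))); first exact: vlim.
  have := rlimD (rlimZ k (vlim x)) (vlim y).
  by congr rlim; apply/funext => n; rewrite pl (Vl n).
have vN x : rnorm (v x) = rnorm (p x).
  apply/eqP; rewrite eq_le; apply/andP; split.
    by apply: (rlim_rnorm_le (vlim x) (n0 := 0)) => n _; rewrite VN.
  apply/ler_addgt0Pr => e e0; have [n0 h] := vlim x e e0.
  have := h n0 (leqnn _); have := rnorm_lip (V n0 (p x)) (v x); rewrite VN; lra.
have v1 x : rnorm (v x) <= 1 * rnorm x by rewrite vN mul1r rnorm_projection.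
have vb : bounded_op v := bopI vl v1.
have va1 := bop_adj_bound vb v1.
have avl : linear (adj v) by case: (bop_adj vb).
have vK n x : (N0 <= n)%N -> v (pK n x) = V n (pK n x).
  move=> n0n; apply: (@rlim_uniq _ _ (fun m => V m (p (pK n x)))); first exact: vlim.
  by move=> e e0; exists n => m nm; rewrite pKx VV ?n0n // subrr rnorm0.
have vp x : v (p x) = v x.
  apply: (@rlim_uniq _ _ (fun m => V m (p x))); last exact: vlim.
  by have := vlim (p x); rewrite ppx.
have vv x : adj v (v x) = p x.
  apply: dot_inj => y; rewrite -adjP // (isometric_dot vl pl vN).
  by rewrite adjP // pa ppx.
have KV n x : (N0 <= n)%N -> pK n (adj (V n) x) = pK n (adj v x).
  move=> n0n; have [Kb _ Ka] := KP n; apply: dot_inj => y.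
  by rewrite -Ka -!adjP // vK.
(* For [n >= N0], whence the shift of the index, [v pK_n v*] is [Q n]; the former tends to
   [v p v* = v v*], the latter to [q]. *)
have vvq x : v (adj v x) = q x.
  apply: (@rlim_uniq _ _ (fun n => Q (n + N0)%N x)); last first.
    move=> e e0; have [n1 h] := pK_strong pi_rep qS x e0.
    by exists n1 => n n1n; apply: h; rewrite (leq_trans n1n) // leq_addr.
  have := rlim_bounded vl v1 (pK_strong pi_rep pS (adj v x)); rewrite vp.
  move=> h e /h[n1 {}h]; exists n1 => n n1n.
  rewrite QE ?leq_addl // KV ?leq_addl // -vK ?leq_addl //.
  by apply: h; rewrite (leq_trans n1n) // leq_addr.
exists v; split.
(* Each [V n \o p] commutes with [S], and this passes to the strong limit. *)
- split=> // S Sc; have [Sb _] := Sc; have [C _ SC] := bop_bound Sb.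
  apply/funext => x /=; apply: (@rlim_uniq _ _ (fun n => V n (p (S x)))); first exact: vlim.
  have := rlim_bounded Sb.1 SC (vlim x); congr rlim; apply/funext => n.
  have [[[_ Vc] _] _] := Vmu n; have [_ [_ pc] _] : open_projection pi p by case: pS => -[].
  have /(congr1 (fun f => f (p x))) /= <- := Vc S Sc.
  by have /(congr1 (fun f => f x)) /= <- := pc S Sc.
- by split=> //; rewrite (_ : adj v \o v = p) //; apply/funext.
- exact/funext.
- exact/funext.
move=> b bher; have Bb := pi_bop pi_rep b; have [Bl _] := Bb.
have /choice[c cE] : forall n, exists c, forall x, pi c x = V n (pi b (adj (V n) x)).
  by move=> n; apply: her_conj_multiplier; case: (Vmu n).
have [|d dE] := @range_pi_closed _ _ _ _ pi_rep pi_univ (v \o pi b \o adj v) c.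
  move=> e e0; have e4 : 0 < e / 4 by rewrite divr_gt0.
  have [n1 h1] := her_tail_all pi_rep pS bher e4.
  have [n2 h2] := her_tail_all pi_rep pS (her_star pP bher) e4.
  exists (maxn N0 (maxn n1 n2)) => n; rewrite !geq_max => /and3P[n0n n1n n2n] x.
  have [Kb _ Ka] := KP n; have KcP := projection_compl (KP n).
  have [Kcb _ Kca] := KcP.
  (* The left tail [(1 - pK n) b] is the adjoint of the right tail of [cstar b]; each side of the
     cut costs [e / 4]. *)
  have cut y : rnorm (pi b y - pK n (pi b (pK n y))) <= e / 2 * rnorm y.
    have -> : pi b y - pK n (pi b (pK n y)) =
        pi b (y - pK n y) + (pi b (pK n y) - pK n (pi b (pK n y))).
      by rewrite (linB Bl) subrKA.
    apply: le_trans (rnormD _ _) _.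
    have := h1 n n1n y.
    have Tb : bounded_op (pi (cstar b) \o (fun z => z - pK n z)).
      by apply: bop_comp => //; exact: pi_bop.
    have := bop_adj_bound Tb (h2 n n2n) (pK n y).
    rewrite adj_comp //; last exact: pi_bop.
    rewrite Kca -(pi_star pi_rep) cstarK /=.
    have : e / 4 * rnorm (pK n y) <= e / 4 * rnorm y by rewrite ler_pM2l // rnorm_projection.
    lra.
  rewrite /= cE.
  (* The two conjugates of [pK n b pK n] cancel, and each remainder costs [e / 2]. *)
  have -> : V n (pi b (adj (V n) x)) - v (pi b (adj v x)) =
      V n (pi b (adj (V n) x) - pK n (pi b (pK n (adj (V n) x)))) -
      v (pi b (adj v x) - pK n (pi b (pK n (adj v x)))).
    rewrite (linB (Vl n)) (linB vl) KV // vK // opprB addrA subrK //.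
  apply: le_trans (rnormB _ _) _.
  rewrite VN; have := cut (adj (V n) x); have := cut (adj v x).
  have := v1 (pi b (adj v x) - pK n (pi b (pK n (adj v x)))).
  have := va1 x.
  have : rnorm (adj (V n) x) <= 1 * rnorm x.
    by apply: bop_adj_bound => // y; rewrite VN mul1r.
  rewrite !mul1r => i1 i2 i3 i4 i5.
  have : e / 2 * rnorm (adj (V n) x) <= e / 2 * rnorm x by rewrite ler_pM2l // divr_gt0.
  have : e / 2 * rnorm (adj v x) <= e / 2 * rnorm x by rewrite ler_pM2l // divr_gt0.
  lra.
exists d; last by apply/funext => x; rewrite dE.
have [_ bp] := (her_iff pi_rep b pP).1 bher.
apply/(her_iff pi_rep _ qP); split=> x; rewrite !dE /=.
  by rewrite -vvq vv vp.
by rewrite -vvq vv bp.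
Qed.

End CuntzEquivalence.

(** * Correction of the phases *)

Lemma multiplier_scale (R : realType) (A : cstarAlgType R) (H : hilbertType R)
  (pi : A -> H -> H) (k : R[i]) (u : H -> H) : star_representation pi ->
  multiplier pi u -> multiplier pi (fun x => k *: u x).
Proof.
move=> pr [[ub uc] um]; split.
  split; first exact: bop_scale.
  move=> S Sc; have [[Sl _] _] := Sc; apply/funext => x /=.
  by rewrite (linZ Sl); congr (_ *: _); have /(congr1 (fun f => f x)) := uc S Sc.
move=> a; have [[b _ bE] [c _ cE]] := um a; split.
  exists (k *: b) => //; apply/funext => x; rewrite (piZ pr) bE //.
exists (k *: c) => //; apply/funext => x; rewrite (piZ pr) cE /=.
by rewrite (linZ (pi_bop pr a).1).
Qed.

Lemma unitary_scale (R : realType) (H : hilbertType R) (k : R[i]) (u : H -> H) :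
  cmod k = 1 -> unitary u -> unitary (fun x => k *: u x).
Proof.
move=> k1 [ub u1 u2]; have [al _] := bop_adj ub.
have kk : k * k^*%C = 1 by rewrite mul_conjc k1 expr1n.
split; first exact: bop_scale; rewrite adj_scale //; apply/funext => x /=.
  by rewrite (linZ ub.1) scalerA kk scale1r -[u _]/((u \o adj u) x) u1.
by rewrite (linZ al) scalerA mulrC kk scale1r -[adj u _]/((adj u \o u) x) u2.
Qed.

Theorem proposition2p8 (R : realType) (A : cstarAlgType R) (H : hilbertType R)
  (pi : A -> H -> H) (p q : H -> H) (w : R -> H -> H)
  (pK : nat -> H -> H) (t : nat -> R) :
  universal_representation pi ->
  sigma_compact_open pi p ->
  sigma_compact_open pi q ->
  (forall s, s \in `[0, 1[ -> multiplier pi (w s) /\ unitary (w s)) ->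
  norm_continuous_path w ->
  w 0 = id ->
  (forall n, t n \in `]0, 1[) ->
  precompact_support pi p pK ->
  precompact_support pi q (fun n => w (t n) \o pK n \o adj (w (t n))) ->
  (forall n s, s \in `[t n, 1[ ->
     w s \o pK n \o adj (w s) = w (t n) \o pK n \o adj (w (t n))) ->
  (forall n s, s \in `[t n, 1[ -> exists lambda : R[i],
     forall x, w s (pK n x) = lambda *: w (t n) (pK n x)) ->
  cuntz_equivalent pi p q.
Proof.
move=> [pr [xi [xiE _ _ _]]] _ _ wmu _ _ t01 pS qS wQ wlam.
have pu : exists xi : (A -> R[i]) -> H,
    forall f, state f -> forall a, f a = dotp (pi a (xi f)) (xi f) by exists xi.
(* [t] need not be monotone; its running maximum [r m] is late enough for the hypotheses at every
   [n <= m]. *)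
pose r := fix r n := if n is n'.+1 then Num.max (r n') (t n) else t 0%N.
have r01 n : 0 < r n < 1.
  elim: n => [|n IH] /=; first by have := t01 0%N; rewrite in_itv.
  have := t01 n.+1; rewrite in_itv /= => h; by case: (leP (r n) (t n.+1)).
have tr m n : (n <= m)%N -> t n <= r m.
  elim: m => [|m IH]; first by rewrite leqn0 => /eqP ->.
  rewrite leq_eqVlt /= le_max => /predU1P[->|/IH ->//].
  by rewrite lexx orbT.
have rI m n : (n <= m)%N -> r m \in `[t n, 1[.
  by move=> nm; rewrite in_itv /= tr //; case/andP: (r01 m).
have r0 n : r n \in `[0, 1[ by rewrite in_itv /=; case/andP: (r01 n) => /ltW -> ->.
pose W n := w (r n).
have WN n x : rnorm (W n x) = rnorm x by apply: rnorm_unitary; case: (wmu _ (r0 n)).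
have Wlam m n : (n <= m)%N -> exists k, forall x, W m (pK n x) = k *: W n (pK n x).
  move=> nm; have [k1 h1] := wlam n _ (rI m n nm); have [k2 h2] := wlam n _ (rI n n (leqnn n)).
  (* If [k2] vanishes, so does [pK n], because the [W n] are isometric, and any scalar will do. *)
  have [k20|k20] := eqVneq k2 0.
    exists 0 => x; rewrite scale0r; apply: rnorm_eq0; rewrite WN -(WN n) /W h2 k20.
    by rewrite scale0r rnorm0.
  by exists (k1 / k2) => x; rewrite /W h1 h2 scalerA divfK.
have [N0 [x0 /eqP x00]] := pK_neq0 pr pS.
(* The phases are read off on the single nonzero projection [pK N0]; isometry makes them
   unimodular. *)
have [lam hlam] : exists lam : nat -> R[i], forall n, cmod (lam n) = 1 /\
    ((N0 <= n)%N -> forall x, W n (pK N0 x) = lam n *: W N0 (pK N0 x)).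
  suff /choice[lam h] : forall n, exists k, cmod k = 1 /\
      ((N0 <= n)%N -> forall x, W n (pK N0 x) = k *: W N0 (pK N0 x)) by exists lam.
  move=> n; have [n0n|_] := leqP N0 n; last by exists 1; rewrite cmod1.
  have [k hk] := Wlam n N0 n0n; exists k; split=> //.
  have nz : rnorm (pK N0 x0) != 0 by rewrite gt_eqF // rnorm_gt0.
  have := congr1 (@rnorm R H) (hk x0); rewrite rnormZ !WN.
  by rewrite -{1}[rnorm _]mul1r => /(mulIf nz).
pose V n x := (lam n)^*%C *: W n x.
have V0 n x : (N0 <= n)%N -> V n (pK N0 x) = W N0 (pK N0 x).
  move=> n0n; have [l1 h] := hlam n; rewrite /V h // scalerA mulrC mul_conjc l1 expr1n.
  by rewrite scale1r.
have lc n : cmod (lam n)^*%C = 1 by rewrite cmod_conj; case: (hlam n).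
have Vmu n : multiplier pi (V n) /\ unitary (V n).
  by have [h1 h2] := wmu _ (r0 n); split; [exact: multiplier_scale|exact: unitary_scale].
apply: (@cuntz_of_unitaries _ _ _ _ pr pu _ _ _ _ V N0 pS qS Vmu).
- move=> m n x /andP[n0n nm].
  have [k hk] := Wlam m n nm.
  have lnz : (lam n)^*%C != 0.
    by apply/eqP => l0; have := lc n; rewrite l0 cmod0 => /esym/eqP; rewrite oner_eq0.
  (* [V m] is [g] times [V n] on the range of [pK n]. This range contains [pK N0 x0], where both
     take the nonzero value [W N0 (pK N0 x0)], so [g = 1]. *)
  pose g := (lam m)^*%C * k / (lam n)^*%C.
  have hg y : V m (pK n y) = g *: V n (pK n y).
    by rewrite /V hk !scalerA /g divfK.
  suff -> : V m (pK n x) = 1 *: V n (pK n x) by rewrite scale1r.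
  rewrite hg; congr (_ *: _).
  have := hg (pK N0 x0); rewrite (pK_mono pS _ n0n).2 !V0 ?(leq_trans n0n) // => h.
  have : (1 - g) *: W N0 (pK N0 x0) = 0 by rewrite scalerBl scale1r -h subrr.
  move=> /eqP; rewrite scaler_eq0 subr_eq0 => /orP[/eqP <-//|/eqP W0].
  by move: x00; rewrite -[_ == _]negbK => /negP[]; apply/negPn/eqP/rnorm_eq0; rewrite -(WN N0) W0 rnorm0.
(* The conjugate of [pK n] is the same at the times [t n] and [r n], and the phases cancel in it. *)
move=> n x n0n; have := wQ n _ (rI n n (leqnn n)) => /(congr1 (fun f => f x)) /= <-.
have [Wm Wu] := wmu _ (r0 n); have [Wb _ _] := Wu.
rewrite /V adj_scale // conjcK; have [[Kl _] _ _] := pK_projection pS n.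
have [l1 _] := hlam n.
by rewrite (linZ Kl) /W (linZ Wb.1) scalerA mulrC mul_conjc l1 expr1n scale1r.
Qed.
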